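(* Let $c\in\mathbb{C}\setminus\mathcal{M}$, let $T_1$ and $T_2$ be the two branches of $f_c^{-1}$, where $f_c(z)=z^2+c$, and let $z_1$ be the fixed point of $T_1$. The series $$\sum_{w\in\{T_1,T_2\}^*}(-1)^{\eta}\Big(w(T_1(-z_1))-w(T_2(-z_1))\Big),$$ where $\eta$ is the number of $T_2$'s in the word $w$, is absolutely convergent if and only if the Hausdorff dimension of the Julia set $J_c$ of $f_c$ is strictly less than one.
   Context: $\mathcal{M}$ is the Mandelbrot set and $J_c$ is the Julia set of $f_c(z)=z^2+c$, which is a Cantor set for $c\notin\mathcal{M}$. For $c\notin\mathcal{M}$ the two branches $T_1,T_2=-T_1$ of $f_c^{-1}$ are the two holomorphic inverse branches of $f_c$ on a closed topological disk $D\supset J_c$ bounded by an equipotential curve $\{G_c=s\}$ with $G_c(0)<s<G_c(c)$ ($G_c$ being the Green's function of the filled Julia set), so that $c\notin D$ and $f_c^{-1}(D)=T_1(D)\sqcup T_2(D)\subset D$; for real $c<-2$ they are $T_1(z)=\sqrt{z-c}$ and $T_2(z)=-\sqrt{z-c}$ on the real interval spanned by $J_c$. Each $T_i$ has a unique fixed point $z_i\in J_c$. $\{T_1,T_2\}^*$ is the set of all finite words in $T_1,T_2$, including the empty word, each word acting as the corresponding composition of maps. *)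

(* Defs.v *)
From mathcomp Require Import all_boot all_order all_algebra complex.
From mathcomp Require Import all_classical all_reals all_analysis.

Set Implicit Arguments.
Unset Strict Implicit.
Unset Printing Implicit Defensive.

Import Order.TTheory GRing.Theory Num.Theory numFieldNormedType.Exports.

Local Open Scope classical_set_scope.
Local Open Scope ring_scope.

(* R[i] has no topology of its own: it gets the one induced by the modulus
   when it is presented as an abstract numClosedFieldType. *)
Definition Cplx (R : realType) : numClosedFieldType := R[i].

(* The real-valued modulus; `|z| itself lives in R[i]. *)
Definition cmod (R : realType) (z : Cplx R) : R := complex.Re `|z|.

Section Hausdorff.
Variable R : realType.
Implicit Types A : set (Cplx R).

(* The point 0 is added so that the diameter of the empty set is 0. *)
Definition diameter A : \bar R :=
  ereal_sup (0%E |` [set (cmod (x - y))%:E | x in A & y in A]).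

Definition hausdorff_content (delta d : R) A : \bar R :=
  ereal_inf [set (\sum_(0 <= k <oo) diameter (U k) `^ d)%E
            | U in [set U : nat -> set (Cplx R) |
                     A `<=` \bigcup_k U k
                     /\ forall k, (diameter (U k) <= delta%:E)%E]].

(* Used for 0 < d only: 0 `^ 0 = 1, so for d = 0 this is not counting measure
   (empty sets of a cover would contribute). *)
Definition hausdorff_measure (d : R) A : \bar R :=
  ereal_sup [set hausdorff_content delta d A | delta in [set e : R | 0 < e]].

Definition hausdorff_dim A : \bar R :=
  ereal_inf [set d%:E | d in [set d : R | 0 < d
                                          /\ hausdorff_measure d A = 0%E]].

End Hausdorff.

Section QuadraticDynamics.
Variable R : realType.
Implicit Types c z : Cplx R.

Definition quad c z : Cplx R := z ^+ 2 + c.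

Definition mandelbrot : set (Cplx R) :=
  [set c | bounded_fun (fun n => iter n (quad c) 0)].

Definition filled_julia c : set (Cplx R) :=
  [set z | bounded_fun (fun n => iter n (quad c) z)].

Definition julia c : set (Cplx R) :=
  closure (filled_julia c) `\` interior (filled_julia c).

(* G_c(z) = lim_n 2^-n log^+ |f_c^n(z)| *)
Definition green c z : R :=
  lim ((fun n => ln (Num.max 1 (cmod (iter n (quad c) z))) / 2 ^+ n) @ \oo).

(* For green c 0 < s this is the closed disk bounded by {green c = s}. *)
Definition green_disk c (s : R) : set (Cplx R) := [set z | green c z <= s].

Definition holomorphic_near (D : set (Cplx R)) (T : Cplx R -> Cplx R) :=
  forall z : Cplx R, D z -> \forall y \near z, derivable T y 1.

(* T1 and T2 are total functions; their values off D are irrelevant. *)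
Definition inverse_branches c (D : set (Cplx R)) (T1 T2 : Cplx R -> Cplx R) :=
  [/\ holomorphic_near D T1, holomorphic_near D T2,
      forall z, D z -> quad c (T1 z) = z,
      forall z, D z -> quad c (T2 z) = z
    & forall z, D z -> T2 z = - T1 z].

End QuadraticDynamics.

(* A word in {T1, T2} is a sequence of booleans, false for T1 and true for T2;
   the leftmost letter is the outermost map of the composition. *)
Definition word_act (T : Type) (T1 T2 : T -> T) (w : seq bool) (z : T) : T :=
  foldr (fun b : bool => if b then T2 else T1) z w.

Definition eta (w : seq bool) : nat := count_mem true w.

Definition absolutely_convergent (R : realType) (I : choiceType)
    (u : I -> Cplx R) : Prop :=
  (\esum_(i in [set: I]) (cmod (u i))%:E < +oo)%E.

(* Main.v *)
Require Import Defs.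
From mathcomp Require Import all_boot all_order all_algebra complex.
From mathcomp Require Import all_classical all_reals all_analysis.
From mathcomp Require Import ring lra.

(** Write f for the quadratic map, E for a sublevel set [{|f^n| <= r1}] between
    the level of the critical point and the given equipotential disk, and
    [|w a1 - w a2|] for the general term of the series, where [a1 = T1 (- z1)]
    and [a2 = T2 (- z1)] are distinct points of E; signs do not affect moduli.
    The Julia set J is the limit set of the contractions T1, T2 of E, and the
    theorem is Bowen's relation between dimension and sums over words, at the
    exponent 1.

    Everything rests on the identity [(T x - T y) (T x + T y) = x - y] for a
    branch T of the inverse.  It gives

    - separation: [|T x + T y|] is bounded below on E ([branch_sum_lower]);

    - contraction: [|w x - w y| <= C l^|w|] with [l < 1]
      ([word_act_contracts]).  The branches map E strictly inside itself, so
      one can expand every letter of a word by a fixed factor about the orbit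
      of a point without leaving E; Cauchy's estimate ([cauchy_estimate])
      bounds the derivative of the expanded word, which is that of the word
      times a factor exponential in its length.  To pass from derivatives
      to diameters one needs that E is connected, which holds because E
      contains the critical point
      ([level_chain]);

    - bounded distortion: [w x - w y] is [x - y] divided by a product of sums
      as above, and contraction makes such products comparable
      ([word_act_distortion]).

    Hence a multiple m(w) of [|w a1 - w a2|] is submultiplicative and comparable
    to the diameter of the cylinder [w(J)].  If the series converges, some level
    has total mass below 1; then so it has with an exponent [d < 1], and the
    covers of J by the cylinders of the multiples of that level show that J has
    dimension at most d.  Conversely, dimension less than 1 yields
    covers of J of small total diameter; by separation each set of the cover
    can be replaced by a single cylinder of comparable size, and by Koenig's
    lemma finitely many of them form a code through which every long word
    factors.  As the code has mass at most 1/2, the series converges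
    geometrically ([limit_set_dim_lt1]). *)

Set Implicit Arguments.
Unset Strict Implicit.
Unset Printing Implicit Defensive.

Import Order.TTheory GRing.Theory Num.Theory numFieldNormedType.Exports.

Local Open Scope classical_set_scope.
Local Open Scope ring_scope.

(** * The modulus and the topology of the complex numbers *)

Section Modulus.
Variable R : realType.
Implicit Types (x y z : Cplx R) (r t : R).

(** The embedding of the reals, with its codomain presented as the abstract
    field [Cplx R], so that the generic algebraic lemmas and tactics apply. *)
Definition rc r : Cplx R := real_complex R r.

Lemma cmodE z : `|z| = rc (cmod z).
Proof. by case: z => a b. Qed.

Lemma rcD r t : rc (r + t) = rc r + rc t. Proof. exact: (rmorphD (real_complex R)). Qed.
Lemma rcB r t : rc (r - t) = rc r - rc t. Proof. exact: (rmorphB (real_complex R)). Qed.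
Lemma rcM r t : rc (r * t) = rc r * rc t. Proof. exact: (rmorphM (real_complex R)). Qed.
Lemma rc0 : rc 0 = 0. Proof. by []. Qed.
Lemma rc1 : rc 1 = 1. Proof. by []. Qed.
Lemma ler_rc r t : (rc r <= rc t) = (r <= t).
Proof. exact: lecR. Qed.
Lemma ltr_rc r t : (rc r < rc t) = (r < t).
Proof. exact: ltcR. Qed.
Lemma rc_inj : injective rc.
Proof. by move=> r t []. Qed.

Lemma cmod_ge0 z : 0 <= cmod z.
Proof. by rewrite -ler_rc -cmodE rc0 normr_ge0. Qed.
Lemma cmodM x y : cmod (x * y) = cmod x * cmod y.
Proof. by apply: rc_inj; rewrite rcM -!cmodE normrM. Qed.
Lemma cmodN x : cmod (- x) = cmod x.
Proof. by rewrite /cmod normrN. Qed.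
Lemma cmodD x y : cmod (x + y) <= cmod x + cmod y.
Proof. by rewrite -ler_rc rcD -!cmodE ler_normD. Qed.
Lemma cmod_eq0 z : (cmod z == 0) = (z == 0).
Proof. by rewrite -(inj_eq rc_inj) -cmodE rc0 normr_eq0. Qed.
Lemma cmod0 : cmod (0 : Cplx R) = 0.
Proof. by apply/eqP; rewrite cmod_eq0. Qed.
Lemma cmod1 : cmod (1 : Cplx R) = 1.
Proof. by apply: rc_inj; rewrite -cmodE normr1. Qed.
Lemma cmod_gt0 z : (0 < cmod z) = (z != 0).
Proof. by rewrite lt_neqAle cmod_ge0 andbT eq_sym cmod_eq0. Qed.
Lemma cmodV z : cmod z^-1 = (cmod z)^-1.
Proof.
have [->|z0] := eqVneq z 0; first by rewrite invr0 cmod0 invr0.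
have cz : cmod z != 0 by rewrite cmod_eq0.
by apply: (mulfI cz); rewrite -cmodM !mulfV // cmod1.
Qed.
Lemma cmodX z n : cmod (z ^+ n) = cmod z ^+ n.
Proof. by elim: n => [|n IH]; rewrite ?expr0 ?cmod1 // !exprS cmodM IH. Qed.
Lemma cmod_rc r : cmod (rc r) = `|r|.
Proof.
apply: rc_inj; rewrite -cmodE.
have [r0|r0] := leP 0 r.
  by rewrite !ger0_norm // -rc0 ler_rc.
by rewrite !ltr0_norm -?rc0 ?ltr_rc //; rewrite -(rmorphN (real_complex R)).
Qed.
Lemma cmodB x y : cmod (x - y) = cmod (y - x).
Proof. by rewrite -cmodN opprB. Qed.
Lemma cmodB_trans x y z : cmod (x - z) <= cmod (x - y) + cmod (y - z).
Proof. by apply: le_trans (cmodD _ _); rewrite addrA subrK. Qed.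
Lemma cmod_triB x y : cmod x - cmod y <= cmod (x - y).
Proof. by rewrite lerBlDr; apply: le_trans (cmodD _ _); rewrite subrK. Qed.
Lemma cmod_sum (I : Type) (s : seq I) (F : I -> Cplx R) :
  cmod (\sum_(i <- s) F i) <= \sum_(i <- s) cmod (F i).
Proof.
elim/big_ind2: _ => //; first by rewrite cmod0.
by move=> a b a' b' h1 h2; apply: le_trans (cmodD _ _) _; apply: lerD.
Qed.
Lemma rc_nat (n : nat) : rc n%:R = n%:R.
Proof. by elim: n => // n IH; rewrite -addn1 !natrD rcD IH. Qed.
Lemma cmod_nat (n : nat) : cmod (n%:R : Cplx R) = n%:R.
Proof. by rewrite -rc_nat cmod_rc ger0_norm. Qed.

Lemma nbhs_cmod (z : Cplx R) (A : set (Cplx R)) :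
  nbhs z A <-> exists2 e : R, 0 < e & forall y, cmod (y - z) < e -> A y.
Proof.
split.
  move=> /nbhs_normP [e /= e0 sub].
  have ere : e = rc (cmod e) by rewrite -cmodE gtr0_norm.
  exists (cmod e); first by rewrite -ltr_rc -ere.
  by move=> y hy; apply: sub => /=; rewrite cmodE ere ltr_rc cmodB.
move=> [e e0 h]; apply/nbhs_normP; exists (rc e) => /=; first by rewrite ltr_rc.
by move=> y /=; rewrite cmodE ltr_rc => hy; apply: h; rewrite cmodB.
Qed.

Lemma bounded_cmod (u : nat -> Cplx R) :
  bounded_fun u <-> exists B : R, forall n, cmod (u n) <= B.
Proof.
split.
  move=> [M [Mr h]].
  have hM : M < rc (cmod M + 1).
    rewrite (le_lt_trans (real_ler_norm Mr)) // cmodE ltr_rc.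
    by rewrite ltrDl.
  exists (cmod M + 1) => n.
  by rewrite -ler_rc -cmodE; apply: (h _ hM).
move=> [B hB]; exists (rc B); split; first by rewrite realE -rc0 !ler_rc; exact: le_total.
move=> x hx n _ /=; apply: le_trans (ltW hx); by rewrite cmodE ler_rc.
Qed.

Lemma cplx_root2 (y : Cplx R) : exists x, x ^+ 2 = y.
Proof. by exists (sqrtC y); rewrite sqrtCK. Qed.

(** Completeness in quantitative form: the tail bound [e] of the sequence
    passes to its limit, which exists because both coordinates converge. *)
Lemma cplx_complete (u : nat -> Cplx R) (e : nat -> R) :
  e @ \oo --> 0 ->
  (forall n m, (n <= m)%N -> cmod (u m - u n) <= e n) ->
  exists l, forall n, cmod (l - u n) <= e n.
Proof.
move=> e0 he.
have leRe (z : Cplx R) : `|complex.Re z| <= cmod z.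
  case: z => a b; rewrite /cmod normc_def /=.
  by rewrite -sqrtr_sqr ler_wsqrtr // lerDl sqr_ge0.
have leIm (z : Cplx R) : `|complex.Im z| <= cmod z.
  case: z => a b; rewrite /cmod normc_def /=.
  by rewrite -sqrtr_sqr ler_wsqrtr // lerDr sqr_ge0.
have leRI (z : Cplx R) : cmod z <= `|complex.Re z| + `|complex.Im z|.
  case: z => a b; rewrite /cmod normc_def /=.
  rewrite -[leRHS]ger0_norm ?addr_ge0 // -sqrtr_sqr ler_wsqrtr //.
  rewrite sqrrD !real_normK ?num_real // lerD2r lerDl.
  by rewrite mulrn_wge0 // mulr_ge0.
have cv (p : Cplx R -> R) : (forall z, `|p z| <= cmod z) -> {morph p : x y / x - y} ->
    cvgn (p \o u).
  move=> hp pB; apply/cauchy_cvgP/cauchy_exP => eps eps0.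
  have /cvgrPdist_lt /(_ _ eps0) [N _ hN] := e0.
  exists (p (u N)); exists N => // m /= Nm.
  rewrite /ball /= -pB; apply: le_lt_trans (hp _) _.
  rewrite cmodB; apply: le_lt_trans (he _ _ Nm) _.
  have := hN N (leqnn N); rewrite /= sub0r normrN; apply: le_lt_trans; exact: ler_norm.
have cvRe := cv _ leRe (fun x y => ltac:(by case: x => ? ?; case: y => ? ?)).
have cvIm := cv _ leIm (fun x y => ltac:(by case: x => ? ?; case: y => ? ?)).
exists (Complex (limn (@complex.Re R \o u)) (limn (@complex.Im R \o u))) => n.
apply/ler_addgt0Pr => eps eps0.
have e20 : 0 < eps / 2 by rewrite divr_gt0.
have /cvgrPdist_lt /(_ _ e20) [N1 _ h1] := cvRe.
have /cvgrPdist_lt /(_ _ e20) [N2 _ h2] := cvIm.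
pose m := maxn n (maxn N1 N2).
apply: le_trans (cmodB_trans _ (u m) _) _; rewrite addrC lerD //.
  by apply: he; rewrite leq_maxl.
apply: le_trans (leRI _) _.
rewrite [eps]splitr; apply: lerD; apply: ltW.
  rewrite [X in `|X|](_ : _ = limn (@complex.Re R \o u) - complex.Re (u m)).
    by apply: h1; rewrite /= !leq_max leqnn orbT.
  by case: (u m).
rewrite [X in `|X|](_ : _ = limn (@complex.Im R \o u) - complex.Im (u m)).
  by apply: h2; rewrite /= !leq_max leqnn !orbT.
by case: (u m).
Qed.
End Modulus.

(** * Cauchy's estimate by sums over roots of unity *)

Lemma geometric_small (R : realType) (C l e : R) : 0 <= l < 1 -> 0 < e ->
  exists N, forall n, (N <= n)%N -> C * l ^+ n < e.
Proof.
move=> /andP[l0 l1] e0.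
have : (fun n => C * l ^+ n) @ \oo --> C * 0.
  by apply: cvgMr; apply: cvg_expr; rewrite ger0_norm.
rewrite mulr0 => /cvgrPdist_lt /(_ _ e0) [N _ hN].
exists N => n Nn; have := hN n Nn; rewrite /= sub0r normrN.
by apply: le_lt_trans; exact: ler_norm.
Qed.

Section Cauchy.
Variable R : realType.
Implicit Types (x y z h k : Cplx R) (r t : R).

Lemma sqr_cmod z : cmod z ^+ 2 = complex.Re z ^+ 2 + complex.Im z ^+ 2.
Proof.
case: z => a b; rewrite /cmod normc_def /= sqr_sqrtr //.
by rewrite addr_ge0 ?sqr_ge0.
Qed.

Lemma cmod_parallelogram z : cmod (z + 1) ^+ 2 + cmod (z - 1) ^+ 2 = 2 * cmod z ^+ 2 + 2.
Proof. rewrite !sqr_cmod; case: z => a b /=; ring. Qed.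

(** Repeated square roots of -1, always taking the root nearer to 1: that root
    [y] has [|y + 1| >= sqrt 2 > 7/5] by the parallelogram identity, so the
    distance to 1 shrinks by the factor 5/7 at each extraction. *)
Lemma small_root_of_unity (e : R) : 0 < e ->
  exists N (z : Cplx R), [/\ (0 < N)%N, z ^+ N = 1, z != 1 & cmod (z - 1) <= e].
Proof.
move=> e0.
have H m : exists z : Cplx R, z ^+ (2 ^ m) = -1 /\ cmod (z - 1) <= 2 * (5 / 7) ^+ m.
  elim: m => [|m [z [zm hz]]].
    exists (-1); split; first by rewrite expn0 expr1.
    by rewrite expr0 mulr1 -opprD cmodN -[1 + 1]/2%:R cmod_nat.
  have [y hy] := cplx_root2 z.
  wlog yy : y hy / cmod (y - 1) <= cmod (y + 1).
    move=> H; have [|h] := leP (cmod (y - 1)) (cmod (y + 1)); first exact: H.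
    apply: (H (- y)); first by rewrite sqrrN.
    rewrite -opprD cmodN; apply: ltW; rewrite -[X in _ < X]cmodN.
    by rewrite opprD opprK.
  exists y; split; first by rewrite expnS exprM hy.
  have y1 : cmod y = 1.
    have : cmod y ^+ (2 ^ m.+1) == 1.
      by rewrite -cmodX expnS exprM hy zm cmodN cmod1.
    by rewrite pexpr_eq1 ?cmod_ge0 ?expn_gt0 // => /eqP.
  have := cmod_parallelogram y; rewrite y1 expr1n.
  have P : cmod (y - 1) * cmod (y + 1) = cmod (z - 1).
    by rewrite -cmodM -hy; congr cmod; ring.
  rewrite [_ ^+ m.+1]exprS; move: (cmod_ge0 (y - 1)) (cmod_ge0 (y + 1)) yy P hz.
  move: (cmod (y - 1)) (cmod (y + 1)) (cmod (z - 1)) ((5/7 : R) ^+ m) => a b d q.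
  move=> a0 b0 ab abd dq pl.
  have b75 : 7 / 5 <= b by nra.
  have : a * (7 / 5) <= 2 * q by rewrite (le_trans _ dq) // -abd ler_wpM2l.
  lra.
have [N /(_ N (leqnn N)) hN] := @geometric_small R 2 (5/7) e ltac:(lra) e0.
have [z [zN hz]] := H N.
exists (2 ^ N.+1)%N, z; split.
- by rewrite expn_gt0.
- by rewrite expnSr exprM zN sqrrN expr1n.
- apply/eqP => z1; move: zN; rewrite z1 expr1n => /eqP.
  by rewrite -subr_eq0 opprK -[1 + 1]/2%:R pnatr_eq0.
- exact: le_trans hz (ltW hN).
Qed.

(** The average of [F (x + h) / h] over a circle of centre [x] does not depend
    on its radius.  Instead of an integral, sums over the N-th roots of unity
    are used: a radial step [h -> (1 + eps) h] and an angular step [h -> z h]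
    with [|z - 1| = eps] have the same first order effect up to the complex
    factor [eps / (z - 1)], because F is complex differentiable, and the
    angular step only permutes the circle.  Each comparison costs [O(eps ^ 2)],
    and [O(1 / eps)] of them join a tiny circle to the given one. *)
Section Averages.
Variables (F F' : Cplx R -> Cplx R) (x : Cplx R) (r L M : R).
Hypotheses (r0 : 0 < r) (L0 : 0 <= L).
Hypothesis hq : forall h k, cmod h <= r -> cmod k <= r ->
  cmod (F (x + k) - F (x + h) - F' (x + h) * (k - h)) <= L * cmod (k - h) ^+ 2.
Hypothesis hM : forall h, cmod h <= r -> cmod (F (x + h)) <= M.

Variables (N : nat) (z : Cplx R).
Hypotheses (N0 : (0 < N)%N) (zN : z ^+ N = 1) (z1 : z != 1).

Let eps : R := cmod (z - 1).
Let q : R := 1 + eps.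
Let A (rho : R) : Cplx R := \sum_(j < N) z ^- j * F (x + rc rho * z ^+ j).

Let cmodz : cmod z = 1.
Proof.
have : cmod z ^+ N == 1 by rewrite -cmodX zN cmod1.
by rewrite pexpr_eq1 ?cmod_ge0 // => /eqP.
Qed.
Let cmodzX j : cmod (z ^+ j) = 1. Proof. by rewrite cmodX cmodz expr1n. Qed.
Let cmodzV j : cmod (z ^- j) = 1. Proof. by rewrite cmodV cmodzX invr1. Qed.
Let z0 : z != 0. Proof. by rewrite -cmod_gt0 cmodz. Qed.
Let eps0 : 0 < eps. Proof. by rewrite cmod_gt0 subr_eq0. Qed.

(** Rotating the circle by [z] permutes the sampling points. *)
Lemma circle_sum_shift rho :
  \sum_(j < N) z ^- j * F (x + z * (rc rho * z ^+ j)) = z * A rho.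
Proof.
pose g j := z ^- j * F (x + rc rho * z ^+ j).
rewrite (eq_bigr (fun j : 'I_N => z * g j.+1)); last first.
  move=> j _; rewrite /g (_ : z * _ = rc rho * z ^+ j.+1); last by rewrite exprS; ring.
  by rewrite exprS; field; rewrite z0 expf_neq0.
rewrite -mulr_sumr; congr (_ * _).
have -> : A rho = \sum_(j < N) g j by [].
case: N N0 zN => // n _ zn; rewrite big_ord_recr big_ord_recl /= addrC.
by congr (_ + _); rewrite /g zn expr0.
Qed.

(** One radial step multiplies the sum by its scaling factor [q], up to two
    Taylor remainders per sampling point. *)
Lemma circle_sum_step rho : 0 <= rho -> q * rho <= r ->
  cmod (A (q * rho) - rc q * A rho) <= N%:R * (2 * L * eps ^+ 2 * rho ^+ 2).
Proof.
move=> rho0 qr.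
have rr : rho <= r by apply: le_trans qr; rewrite ler_peMl // lerDl ltW.
have zz : z - 1 != 0 by rewrite subr_eq0.
(* Taylor remainders of the radial and of the angular step *)
pose e1 h := F (x + rc q * h) - F (x + h) - F' (x + h) * (rc q * h - h).
pose e2 h := F (x + z * h) - F (x + h) - F' (x + h) * (z * h - h).
have -> : A (q * rho) - rc q * A rho =
   \sum_(j < N) z ^- j * (e1 (rc rho * z ^+ j) - rc eps / (z - 1) * e2 (rc rho * z ^+ j)).
  have -> : rc q * A rho = A rho + rc eps / (z - 1) * (z * A rho - A rho).
    rewrite /q rcD rc1 mulrDl mul1r; congr (_ + _).
    rewrite -[X in _ * (_ - X)]mul1r -mulrBl mulrA divfK //.
  rewrite -circle_sum_shift /A -sumrB mulr_sumr -big_split /= -sumrB.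
  apply: eq_bigr => j _; rewrite /e1 /e2 rcM -[rc q * _ * _]mulrA.
  rewrite {3}/q rcD rc1; move: (rc rho * z ^+ j) => h; field.
  by rewrite zz expf_neq0.
apply: le_trans (cmod_sum _ _) _.
apply: le_trans (_ : \sum_(j < N) (2 * L * eps ^+ 2 * rho ^+ 2) <= _); last first.
  by rewrite sumr_const card_ord -[leLHS]mulr_natl.
apply: ler_sum => j _; rewrite cmodM cmodzV mul1r.
set h := rc rho * z ^+ j.
have ch : cmod h = rho by rewrite cmodM cmodzX mulr1 cmod_rc ger0_norm.
apply: le_trans (cmodD _ _) _.
rewrite cmodN cmodM cmodM cmodV cmod_rc ger0_norm ?(ltW eps0) // mulfV ?gt_eqF // mul1r.
have b1 : cmod (e1 h) <= L * (eps * rho) ^+ 2.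
  apply: le_trans (@hq h (rc q * h) _ _) _; rewrite ?ch //.
    by rewrite cmodM ch cmod_rc ger0_norm // addr_ge0 // ltW.
  rewrite (_ : rc q * h - h = rc eps * h); last by rewrite /q rcD rc1; ring.
  by rewrite cmodM ch cmod_rc ger0_norm // ltW.
have b2 : cmod (e2 h) <= L * (eps * rho) ^+ 2.
  apply: le_trans (@hq h (z * h) _ _) _; rewrite ?ch //.
    by rewrite cmodM ch cmodz mul1r.
  rewrite (_ : z * h - h = (z - 1) * h); last by ring.
  by rewrite cmodM ch.
apply: le_trans (lerD b1 b2) _; rewrite le_eqVlt; apply/orP; left; apply/eqP; ring.
Qed.

Lemma circle_sum_bound : cmod (A r) <= N%:R * M.
Proof.
apply: le_trans (cmod_sum _ _) _.
apply: le_trans (_ : \sum_(j < N) M <= _); last first.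
  by rewrite sumr_const card_ord -[leLHS]mulr_natl.
apply: ler_sum => j _; rewrite cmodM cmodzV mul1r.
by apply: hM; rewrite cmodM cmodzX mulr1 cmod_rc ger0_norm // ltW.
Qed.

(** On a small circle only the linear term of F survives, since the nontrivial
    powers of [z] sum to 0. *)
Lemma circle_sum_center rho : 0 <= rho -> rho <= r ->
  cmod (A rho - N%:R * (rc rho * F' x)) <= N%:R * (L * rho ^+ 2).
Proof.
move=> rho0 rr.
have S0 : \sum_(j < N) z ^- j = 0.
  have zV : z^-1 - 1 != 0.
    by rewrite subr_eq0; apply: contra_neq z1 => h; rewrite -[z]invrK h invr1.
  apply: (mulfI zV); rewrite mulr0.
  rewrite (eq_bigr (fun j : 'I_N => z^-1 ^+ j)); last by move=> j _; rewrite exprVn.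
  by rewrite -subrX1 exprVn zN invr1 subrr.
have -> : A rho - N%:R * (rc rho * F' x) =
  \sum_(j < N) z ^- j * (F (x + rc rho * z ^+ j) - F (x + 0) - F' (x + 0) * (rc rho * z ^+ j - 0)).
  rewrite [RHS](eq_bigr (fun j : 'I_N => z ^- j * F (x + rc rho * z ^+ j) -
    (F x * z ^- j + rc rho * F' x))).
    by rewrite sumrB big_split /= -mulr_sumr S0 mulr0 add0r sumr_const card_ord mulr_natl.
  move=> j _; rewrite !addr0 subr0; field; exact: expf_neq0.
apply: le_trans (cmod_sum _ _) _.
apply: le_trans (_ : \sum_(j < N) (L * rho ^+ 2) <= _); last first.
  by rewrite sumr_const card_ord -[leLHS]mulr_natl.
apply: ler_sum => j _; rewrite cmodM cmodzV mul1r.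
have ch : cmod (rc rho * z ^+ j) = rho by rewrite cmodM cmodzX mulr1 cmod_rc ger0_norm.
by apply: le_trans (@hq 0 _ _ _) _; rewrite ?cmod0 ?subr0 ?ch // ltW.
Qed.

Lemma circle_sum_iter rho m : 0 < rho -> q ^+ m * rho <= r ->
  cmod (A (q ^+ m * rho) - rc (q ^+ m) * A rho)
    <= N%:R * (2 * L * eps ^+ 2 * r * m%:R * (q ^+ m * rho)).
Proof.
move=> rho0; have q1 : 1 <= q by rewrite /q lerDl ltW.
have q0 : 0 <= q by apply: le_trans q1.
elim: m => [_|m IH hm].
  by rewrite expr0 !mul1r subrr cmod0 mulr0 mul0r mulr0.
have hm' : q ^+ m * rho <= r.
  by apply: le_trans hm; rewrite ler_wpM2r ?(ltW rho0) // ler_weXn2l.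
have qm0 : 0 <= q ^+ m by rewrite exprn_ge0.
have p0 : 0 <= q ^+ m * rho by rewrite mulr_ge0 // ltW.
have := @circle_sum_step (q ^+ m * rho) p0; rewrite mulrA -exprS => /(_ hm) st.
apply: le_trans (cmodB_trans _ (rc q * A (q ^+ m * rho)) _) _.
have -> : rc q * A (q ^+ m * rho) - rc (q ^+ m.+1) * A rho =
   rc q * (A (q ^+ m * rho) - rc (q ^+ m) * A rho).
  by rewrite exprS rcM; ring.
rewrite cmodM cmod_rc ger0_norm //.
apply: le_trans (lerD st (ler_wpM2l q0 (IH hm'))) _.
have -> : N%:R * (2 * L * eps ^+ 2 * r * m.+1%:R * (q ^+ m.+1 * rho)) =
  N%:R * (2 * L * eps ^+ 2 * (r * (q * (q ^+ m * rho)))) +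
  q * (N%:R * (2 * L * eps ^+ 2 * r * m%:R * (q ^+ m * rho))).
  by rewrite [q ^+ m.+1]exprS -(natr1 m); ring.
rewrite lerD2r; apply: ler_wpM2l => //.
apply: ler_wpM2l; first by rewrite !mulr_ge0 ?(ltW eps0).
rewrite [leLHS]expr2.
by apply: ler_pM => //; rewrite ler_peMl.
Qed.

Lemma circle_sum_conclusion m :
  cmod (F' x) <= M / r + 2 * L * eps ^+ 2 * r * m%:R + L * (r / q ^+ m).
Proof.
have q1 : 1 <= q by rewrite /q lerDl ltW.
have qm : 0 < q ^+ m by rewrite exprn_gt0 // (lt_le_trans ltr01).
pose rho := r / q ^+ m.
have rho0 : 0 < rho by rewrite divr_gt0.
have er : q ^+ m * rho = r by rewrite /rho mulrC divfK // gt_eqF.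
have rr : rho <= r by rewrite ler_pdivrMr // ler_peMr ?(ltW r0) // exprn_ege1.
have h1 := @circle_sum_iter rho m rho0; rewrite er in h1; have {}h1 := h1 (lexx _).
have h2 := circle_sum_center (ltW rho0) rr.
have h3 := circle_sum_bound.
have Nr0 : 0 < N%:R :> R by rewrite ltr0n.
have E : N%:R * (rc r * F' x) = A r - (A r - rc (q ^+ m) * A rho)
   - rc (q ^+ m) * (A rho - N%:R * (rc rho * F' x)).
  rewrite -[in LHS]er rcM; ring.
have : N%:R * (r * cmod (F' x)) <= N%:R * M + N%:R * (2 * L * eps ^+ 2 * r * m%:R * r)
    + q ^+ m * (N%:R * (L * rho ^+ 2)).
  rewrite -{1}(ger0_norm (ltW r0)) -cmod_rc -cmodM -cmod_nat -cmodM E cmod_nat.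
  apply: le_trans (cmodD _ _) _; apply: lerD.
    apply: le_trans (cmodD _ _) _; apply: lerD => //.
    by rewrite cmodN.
  by rewrite cmodN cmodM cmod_rc ger0_norm ?(ltW qm) // ler_wpM2l // ltW.
have -> : q ^+ m * (N%:R * (L * rho ^+ 2)) = N%:R * (r * (L * rho)).
  by rewrite -er; ring.
rewrite -!mulrDr ler_pM2l // => H.
rewrite -(ler_pM2l r0); apply: le_trans H _; rewrite le_eqVlt; apply/orP; left; apply/eqP.
by rewrite -/rho; field; rewrite gt_eqF.
Qed.

End Averages.

(** Cauchy's estimate for the derivative at the centre of a disk, for functions
    with a uniform second order Taylor remainder.  The bound is independent of
    the remainder constant [L], so it will be uniform over all words. *)
Lemma cauchy_estimate (F F' : Cplx R -> Cplx R) x (r L M : R) : 0 < r -> 0 <= L ->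
  (forall h k, cmod h <= r -> cmod k <= r ->
    cmod (F (x + k) - F (x + h) - F' (x + h) * (k - h)) <= L * cmod (k - h) ^+ 2) ->
  (forall h, cmod h <= r -> cmod (F (x + h)) <= M) ->
  cmod (F' x) <= M / r.
Proof.
move=> r0 L0 hq hM; apply/ler_addgt0Pr => t t0.
(* [m] radial steps of ratio [1 + e] with [m * e] between [X] and [X + 1]: the
   inner circle then has radius at most [r / (1 + X)], small enough for the
   error at the centre, and [e0] makes the total error of the steps small. *)
pose X : R := 2 * L * r / t.
have X0 : 0 <= X by rewrite divr_ge0 ?mulr_ge0 // ltW.
pose e0 : R := Num.min 1 (t / (4 * (L + 1) * r * (X + 1))).
have L1 : 0 < L + 1 by rewrite ltr_wpDl.
have X1 : 0 < X + 1 by rewrite ltr_wpDl.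
have e00 : 0 < e0 by rewrite lt_min ltr01 divr_gt0 // !mulr_gt0.
have [N [z [N0 zN z1 hz]]] := small_root_of_unity e00.
set e := cmod (z - 1) in hz.
have ep : 0 < e by rewrite cmod_gt0 subr_eq0.
have [e1 e2] : e <= 1 /\ e <= t / (4 * (L + 1) * r * (X + 1)).
  by move: hz; rewrite le_min => /andP.
pose m := (Num.truncn (X / e)).+1.
have Xe0 : 0 <= X / e by rewrite divr_ge0 // ltW.
have m1 : X <= m%:R * e.
  by rewrite -ler_pdivrMr // ltW // truncnS_gt.
have m2 : m%:R * e <= X + 1.
  rewrite /m -natr1 mulrDl mul1r; apply: lerD => //.
  by rewrite -ler_pdivlMr // truncn_le.
have := circle_sum_conclusion r0 L0 hq hM N0 zN z1 m; rewrite -/e => H.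
apply: le_trans H _; rewrite -addrA lerD2l [t]splitr; apply: lerD.
  have -> : 2 * L * e ^+ 2 * r * m%:R = 2 * L * r * e * (m%:R * e) by ring.
  apply: le_trans (_ : 2 * L * r * (t / (4 * (L + 1) * r * (X + 1))) * (X + 1) <= _).
    apply: ler_pM => //; rewrite ?mulr_ge0 ?(ltW r0) ?(ltW ep) //.
    by apply: ler_wpM2l => //; rewrite !mulr_ge0 // ltW.
  have -> : 2 * L * r * (t / (4 * (L + 1) * r * (X + 1))) * (X + 1) = t / 2 * (L / (L + 1)).
    by field; rewrite !gt_eqF.
  by rewrite ler_piMr ?divr_ge0 ?(ltW t0) // ler_pdivrMr // mul1r lerDl.
have qm : 1 + X <= (1 + e) ^+ m.
  apply: le_trans (_ : 1 + m%:R * e <= _); first by rewrite lerD2l.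
  elim: (m) => [|k IH]; first by rewrite mul0r addr0.
  rewrite exprS; apply: le_trans (ler_wpM2l _ IH); last by rewrite addr_ge0 // ltW.
  rewrite -natr1; have : 0 <= k%:R * e * e by rewrite !mulr_ge0 // ltW.
  lra.
have X1' : 0 < 1 + X by rewrite addrC.
apply: le_trans (_ : L * (r / (1 + X)) <= _).
  rewrite !ler_wpM2l ?(ltW r0) // lef_pV2 ?posrE //.
  by apply: lt_le_trans qm.
rewrite mulrA ler_pdivrMr // mulrDr mulr1 /X.
have -> : t / 2 * (2 * L * r / t) = L * r by field; rewrite gt_eqF.
by rewrite lerDr divr_ge0 // ltW.
Qed.
End Cauchy.

(** * The Green function and polynomial level sets *)

Section Green.
Variables (R : realType) (c : Cplx R).
Implicit Types (x y z : Cplx R).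

Lemma quadB x y : quad c x - quad c y = (x - y) * (x + y).
Proof. by rewrite /quad; ring. Qed.

Lemma cmod_quad_le z : cmod (quad c z) <= cmod z ^+ 2 + cmod c.
Proof. by rewrite -cmodX; exact: cmodD. Qed.

Lemma cmod_quad_ge z : cmod z ^+ 2 <= cmod (quad c z) + cmod c.
Proof.
rewrite -cmodX (_ : z ^+ 2 = quad c z - c); last by rewrite /quad addrK.
by apply: le_trans (cmodD _ _) _; rewrite cmodN.
Qed.

Let lm z : R := ln (Num.max 1 (cmod z)).

Let max1_gt0 (r : R) : 0 < Num.max 1 r.
Proof. by rewrite lt_max ltr01. Qed.

(** Both directions of the comparison lose only the factor [1 + |c|]:
    [max(1,|f z|) <= (1 + |c|) max(1,|z|)^2] and
    [max(1,|z|)^2 <= (1 + |c|) max(1,|f z|)]. *)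
Lemma ln_max_quad z :
  `|lm (quad c z) - 2 * lm z| <= ln (1 + cmod c).
Proof.
have c0 := cmod_ge0 c; have z0 := cmod_ge0 z; have q0 := cmod_ge0 (quad c z).
have c1 : 0 < 1 + cmod c by lra.
set a := Num.max 1 (cmod z); set b := Num.max 1 (cmod (quad c z)).
have a0 : 0 < a by exact: max1_gt0.
have b0 : 0 < b by exact: max1_gt0.
have [a1 a2] : 1 <= a /\ cmod z <= a by rewrite !le_max !lexx orbT.
have [b1 b2] : 1 <= b /\ cmod (quad c z) <= b by rewrite !le_max !lexx orbT.
have H1 : b <= a ^+ 2 * (1 + cmod c).
  have ha : 1 <= a ^+ 2 by rewrite exprn_ege1.
  have hz : cmod z ^+ 2 <= a ^+ 2 by rewrite ler_pXn2r ?nnegrE // ltW.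
  rewrite ge_max; apply/andP; split; first by nra.
  by apply: le_trans (cmod_quad_le z) _; nra.
have H2 : a ^+ 2 <= b * (1 + cmod c).
  rewrite /a; have [h|h] := leP 1 (cmod z).
    by apply: le_trans (cmod_quad_ge z) _; nra.
  by rewrite expr1n; nra.
have -> : 2 * lm z = ln (a ^+ 2) by rewrite lnXn // mulr_natl.
have {}H1 : ln b <= ln (a ^+ 2) + ln (1 + cmod c).
  by rewrite -lnM ?posrE ?exprn_gt0 // ler_ln ?posrE ?mulr_gt0 ?exprn_gt0.
have {}H2 : ln (a ^+ 2) <= ln b + ln (1 + cmod c).
  by rewrite -lnM ?posrE ?exprn_gt0 // ler_ln ?posrE ?mulr_gt0 ?exprn_gt0.
rewrite ler_norml; apply/andP; rewrite /lm -/b; split; lra.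
Qed.

(** The approximants of the Green function converge geometrically, uniformly
    over the whole plane. *)
Lemma green_approx n z :
  `|green c z - lm (iter n (quad c) z) / 2 ^+ n| <= ln (1 + cmod c) / 2 ^+ n.
Proof.
pose a n := lm (iter n (quad c) z) / 2 ^+ n.
pose d n : R := ln (1 + cmod c) / 2 ^+ n.
have st k : `|a k.+1 - a k| <= d k - d k.+1.
  have p0 : 0 < 2 ^+ k.+1 :> R by rewrite exprn_gt0.
  have p1 : 2 ^+ k != 0 :> R by rewrite expf_neq0.
  have -> : a k.+1 - a k =
    (lm (quad c (iter k (quad c) z)) - 2 * lm (iter k (quad c) z)) / 2 ^+ k.+1.
    by rewrite /a iterS exprS; field.
  have -> : d k - d k.+1 = ln (1 + cmod c) / 2 ^+ k.+1.
    by rewrite /d exprS; field.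
  rewrite normrM normfV (gtr0_norm p0) ler_pdivrMr // divfK ?gt_eqF //.
  exact: ln_max_quad.
have tel k m : (k <= m)%N -> `|a m - a k| <= d k - d m.
  move=> /subnK <-; elim: (m - k)%N => [|j IH]; first by rewrite !subrr normr0.
  rewrite addSn; apply: le_trans (ler_distD (a (j + k)%N) _ _) _.
  apply: le_trans (lerD (st _) IH) _; lra.
have d_ge0 k : 0 <= d k.
  by rewrite divr_ge0 ?exprn_ge0 // ln_ge0 // lerDl cmod_ge0.
have d0 : d @ \oo --> 0.
  rewrite -(mulr0 (ln (1 + cmod c))); apply: cvgMr.
  under eq_fun do rewrite -exprVn.
  by apply: cvg_expr; rewrite gtr0_norm ?invr_gt0 // invf_lt1 // ltr1n.
have ca : cvgn a.
  apply/cauchy_cvgP/cauchy_exP => eps eps0.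
  have /cvgrPdist_lt /(_ _ eps0) [N _ hN] := d0.
  exists (a N); exists N => // m /= Nm; rewrite /ball /= distrC.
  apply: le_lt_trans (tel _ _ Nm) _.
  have := hN N (leqnn N); rewrite /= sub0r normrN ger0_norm //.
  by apply: le_lt_trans; rewrite gerBl.
have cd : (fun m => `|a m - a n|) @ \oo --> `|green c z - a n|.
  by apply: cvg_norm; apply: cvgB; [exact: ca|exact: cvg_cst].
rewrite -/(a n) -/(d n) -(cvg_lim _ cd) //.
apply: limr_le; first by apply/cvg_ex; eexists; exact: cd.
by exists n => // m /= nm; apply: le_trans (tel _ _ nm) _; rewrite gerBl.
Qed.

(** Between the levels [green c 0] and [s] there is room for two sublevel sets
    of a polynomial [f ^ n].  The smaller one is the domain E of the inverse
    branches, the larger one a neighbourhood of E on which they are still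
    defined. *)
Lemma exists_polynomial_disk (s : R) (r0 : R) :
  green c 0 < s -> s < green c c ->
  exists n (r1 r2 : R), [/\ r0 <= r1, r1 < r2, cmod (iter n (quad c) 0) <= r1,
    r2 < cmod (iter n (quad c) c) &
    forall z, cmod (iter n (quad c) z) <= r2 -> green_disk c s z].
Proof.
move=> h0 hc; set g0 := green c 0 in h0 *.
pose t := (s - g0) / 4; have t0 : 0 < t by rewrite /t; lra.
have es : s = g0 + 4 * t by rewrite /t; lra.
have lc : 0 <= ln (1 + cmod c) by rewrite ln_ge0 // lerDl cmod_ge0.
have lm0 z : 0 <= lm z by rewrite ln_ge0 // le_max lexx.
have [N hN] : exists N, forall n, (N <= n)%N -> ln (1 + cmod c) / 2 ^+ n < t.
  have [|N hN] := @geometric_small R (ln (1 + cmod c)) 2^-1 t _ t0.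
    by rewrite invr_ge0 ler0n invf_lt1 // ltr1n.
  by exists N => n /hN; rewrite exprVn.
have [N' hN'] : exists N, forall n, (N <= n)%N -> `|r0| / 2 ^+ n < t.
  have [|N' hN'] := @geometric_small R `|r0| 2^-1 t _ t0.
    by rewrite invr_ge0 ler0n invf_lt1 // ltr1n.
  by exists N' => n /hN'; rewrite exprVn.
pose n := maxn N N'.
have {}hN := hN n (leq_maxl _ _); have {}hN' := hN' n (leq_maxr _ _).
have ap z : `|green c z - lm (iter n (quad c) z) / 2 ^+ n| < t.
  exact: le_lt_trans (green_approx n z) hN.
have p0 : 0 < 2 ^+ n :> R by rewrite exprn_gt0.
have g00 : 0 <= g0.
  rewrite leNgt; apply/negP => g0neg.
  have [||M /(_ M (leqnn M)) hM] := @geometric_small R (ln (1 + cmod c)) 2^-1 (- g0).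
  - by rewrite invr_ge0 ler0n invf_lt1 // ltr1n.
  - by rewrite oppr_gt0.
  have := green_approx M 0; rewrite -exprVn ler_distlC => /andP[_ ].
  have : 0 <= lm (iter M (quad c) 0) * 2^-1 ^+ M by rewrite mulr_ge0 // exprn_ge0.
  rewrite -/g0; lra.
have lmE z (X : R) : 0 <= X -> (lm z <= X) = (cmod z <= expR X).
  move=> X0; rewrite -{1}(expRK X) ler_ln ?posrE ?expR_gt0 // ge_max.
  by rewrite (_ : 1 <= expR X) // -expR0 ler_expR.
have X1 : 0 <= (g0 + t) * 2 ^+ n by rewrite mulr_ge0 ?(ltW p0) //; lra.
have X2 : 0 <= (g0 + 2 * t) * 2 ^+ n by rewrite mulr_ge0 ?(ltW p0) //; lra.
exists n, (expR ((g0 + t) * 2 ^+ n)), (expR ((g0 + 2 * t) * 2 ^+ n)); split.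
- apply: le_trans (expR_ge1Dx _).
  apply: le_trans (ler_norm r0) _; rewrite ltr_pdivrMr // in hN'.
  rewrite mulrDl; have := mulr_ge0 g00 (ltW p0); lra.
- by rewrite ltr_expR ltr_pM2r //; lra.
- rewrite -lmE // -ler_pdivrMr //; have := ap 0; rewrite -/g0 ltr_distlC; lra.
- rewrite ltNge -lmE // -ltNge -ltr_pdivlMr //.
  have := ap c; rewrite ltr_distlC; lra.
- move=> z; rewrite -lmE // -ler_pdivrMr // /green_disk /=.
  have := ap z; rewrite ltr_distlC; lra.
Qed.
End Green.

(** * Connectedness of level sets *)

Section Levels.
Variables (R : realType) (c : Cplx R).
Implicit Types (x y z : Cplx R) (r : R).

Definition level k r : set (Cplx R) := [set z | cmod (iter k (quad c) z) <= r].

Lemma quad_preim_small r z : cmod c + 3 <= r ->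
  cmod (quad c z) <= r -> cmod z <= r - 1.
Proof.
move=> hr hz; have := cmod_quad_ge c z.
have := cmod_ge0 z; have := cmod_ge0 c.
move: (cmod z) (cmod c) hr hz => a d hr hz d0 a0 h.
rewrite leNgt; apply/negP => ra; nra.
Qed.

Lemma level_norm k r z : cmod c + 3 <= r -> level k r z -> cmod z <= r.
Proof.
move=> hr; elim: k z => [//|k IH] z; rewrite /level /= -iterS iterSr => /IH.
by move/(quad_preim_small hr) => h; lra.
Qed.

Lemma levelS_inner k r z : cmod c + 3 <= r -> level k.+1 r z -> level k (r - 1) z.
Proof. by move=> hr; rewrite /level /=; exact: quad_preim_small. Qed.

Lemma levelS_quad k r z : level k.+1 r z = level k r (quad c z).
Proof. by rewrite /level /= -iterS iterSr. Qed.

Lemma levelS_sub k r z : cmod c + 3 <= r -> level k.+1 r z -> level k r z.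
Proof. move=> hr /(levelS_inner hr); rewrite /level /=; lra. Qed.

Lemma level_sub k m r z : (k <= m)%N -> cmod c + 3 <= r -> level m r z -> level k r z.
Proof.
move=> /subnK <- hr; elim: (m - k)%N => // j IH; rewrite addSn.
by move/(levelS_sub hr).
Qed.

Lemma iter_quad_lipschitz k (B : R) : exists2 L : R, 0 < L &
  forall x y, cmod x <= B -> cmod y <= B ->
    cmod (iter k (quad c) x - iter k (quad c) y) <= L * cmod (x - y).
Proof.
elim: k B => [|k IH] B; first by exists 1 => // x y _ _; rewrite mul1r.
have [L L0 hL] := IH (B ^+ 2 + cmod c).
have [B0|B0] := leP 0 B; last first.
  by exists 1 => // x y hx; have := cmod_ge0 x; lra.
exists (L * (2 * B + 1)); first by rewrite mulr_gt0 //; lra.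
have sB x : cmod x <= B -> cmod (quad c x) <= B ^+ 2 + cmod c.
  move=> hx; apply: le_trans (cmod_quad_le _ _) _.
  by rewrite lerD2r ler_pXn2r ?nnegrE // cmod_ge0.
move=> x y hx hy; rewrite !iterSr; apply: le_trans (hL _ _ (sB x hx) (sB y hy)) _.
rewrite quadB cmodM -mulrA ler_pM2l // mulrC ler_wpM2r ?cmod_ge0 //.
by apply: le_trans (cmodD _ _) _; lra.
Qed.

Lemma level_thicken k (a b : R) : cmod c + 3 <= b -> a < b -> exists2 d : R, 0 < d &
  forall x y, level k a x -> cmod (y - x) <= d -> level k b y.
Proof.
move=> hb ab; have [L L0 hL] := iter_quad_lipschitz k (b + 1).
exists (Num.min 1 ((b - a) / L)).
  by rewrite lt_min ltr01 divr_gt0 // subr_gt0.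
move=> x y hx; rewrite le_min => /andP[h1 h2].
have xb : cmod x <= b by apply: (@level_norm k) => //; rewrite /level /= (le_trans hx) // ltW.
have yb : cmod y <= b + 1.
  by have := cmodD (y - x) x; rewrite subrK; lra.
have xb' : cmod x <= b + 1 by lra.
have := hL _ _ yb xb'; rewrite ler_pdivlMr // in h2.
move=> h; rewrite /level /=.
have := cmod_triB (iter k (quad c) y) (iter k (quad c) x).
rewrite /level /= in hx; rewrite mulrC in h2; lra.
Qed.

(** Chains of small steps inside S; they stand for connectedness, with the
    number of steps made explicit. *)
Fixpoint chain (S : set (Cplx R)) (e : R) m x y : Prop :=
  if m is m'.+1 then exists z, [/\ S z, cmod (z - x) <= e & chain S e m' z y] else x = y.

Lemma chain_cat S e m m' x y z : chain S e m x y -> chain S e m' y z ->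
  chain S e (m + m') x z.
Proof.
elim: m x => [|m IH] x /=; first by move=> ->.
by move=> [t [h1 h2 h3]] h4; exists t; split=> //; apply: IH h4.
Qed.

Lemma chain_rev S e m x y : S x -> chain S e m x y -> chain S e m y x.
Proof.
elim: m x => [|m IH] x Sx; first by move=> /= ->.
move=> [z [Sz h hc]]; rewrite -(addn1 m); apply: (@chain_cat _ _ _ _ _ z); first exact: IH.
by exists x; split=> //; rewrite cmodB.
Qed.

(** Over a step of length [e ^ 2], one of the two preimages lies within [e],
    because the product of the distances to the preimages is the length of the
    step. *)
Lemma chain_lift (S : set (Cplx R)) e m x y : 0 <= e ->
  chain S (e ^+ 2) m (quad c x) y ->
  exists2 x', quad c x' = y & chain (quad c @^-1` S) e m x x'.
Proof.
move=> e0; elim: m x => [|m IH] x /=; first by move=> <-; exists x.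
move=> [z [Sz hz hc]].
have [t ht] := cplx_root2 (z - c).
have qt u : u ^+ 2 = t ^+ 2 -> quad c u = z by move=> h; rewrite /quad h ht subrK.
wlog ht' : t ht qt / cmod (t - x) <= e.
  move=> W; have [h|h] := leP (cmod (t - x)) e; first exact: (W t).
  apply: (W (- t)) => //; rewrite ?sqrrN // leNgt; apply/negP => h'.
  have : cmod (t - x) * cmod (- t - x) <= e ^+ 2.
    rewrite -cmodM (_ : _ * _ = - (z - quad c x)) ?cmodN //.
    by rewrite -(qt t erefl) quadB; ring.
  by rewrite leNgt expr2 ltr_pM.
have qtz : quad c t = z by exact: qt.
have := IH t; rewrite qtz => /(_ hc) [x' e1 e2].
exists x' => //; exists t; split=> //=.
by rewrite qtz.
Qed.

Lemma disk_chain r e : 0 < e -> exists m, forall x, cmod x <= r ->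
  chain (level 0 r) e m x 0.
Proof.
move=> e0; pose m := (Num.truncn (r / e)).+1; exists m.
move=> x hx.
have hm : cmod x <= m%:R * e.
  apply: le_trans hx _; have [h|h] := leP 0 r; last first.
    by apply: le_trans (ltW h) _; rewrite mulr_ge0 // ltW.
  by rewrite -ler_pdivrMr // ltW // truncnS_gt.
elim: m x hx hm => [|k IH] x hx hm.
  by apply/eqP; rewrite -cmod_eq0 eq_le cmod_ge0 andbT; rewrite mul0r in hm.
exists (rc (k%:R / k.+1%:R) * x).
have q0 : 0 <= (k%:R / k.+1%:R : R) by rewrite divr_ge0.
have q1 : (k%:R / k.+1%:R : R) <= 1 by rewrite ler_pdivrMr // mul1r ler_nat.
have cz : cmod (rc (k%:R / k.+1%:R) * x) = k%:R / k.+1%:R * cmod x.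
  by rewrite cmodM cmod_rc ger0_norm.
have hz : cmod (rc (k%:R / k.+1%:R) * x) <= r.
  by rewrite cz; apply: le_trans hx; rewrite ler_piMl // cmod_ge0.
split=> //; last first.
  apply: IH => //; rewrite cz -mulrA ler_wpM2l // mulrC ler_pdivrMr //.
  by rewrite mulrC.
have -> : rc (k%:R / k.+1%:R) * x - x = rc (- (k.+1%:R)^-1) * x.
  rewrite -[X in _ - X]mul1r -rc1 -mulrBl -rcB; congr (rc _ * _).
  by rewrite -natr1; field; rewrite natr1 pnatr_eq0.
by rewrite cmodM cmod_rc normrN ger0_norm ?invr_ge0 // mulrC ler_pdivrMr // mulrC.
Qed.

(** Level sets that contain the critical point are connected, uniformly:
    preimages of a chain to the critical value [c] end at the only preimage 0
    of [c].  Induction starts from a round disk. *)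
Lemma level_chain n r e : cmod c + 3 <= r -> level n r 0 -> 0 < e ->
  exists m, forall x, level n r x -> chain (level n r) e m x 0.
Proof.
move=> hr h0; suff H k : (k <= n)%N -> forall e, 0 < e -> exists m, forall x,
    level k r x -> chain (level k r) e m x 0 by exact: H.
elim: k => [_ e' e0'|k IH kn e' e0']; first by have [m hm] := disk_chain r e0'; exists m.
have lc : level k r c.
  rewrite (_ : c = quad c 0); last by rewrite /quad expr0n add0r.
  by rewrite -levelS_quad; apply: level_sub h0.
have [m hm] := IH (ltnW kn) (e' ^+ 2) (exprn_gt0 2 e0').
exists (m + m)%N => x; rewrite levelS_quad => hx.
have ch := chain_cat (hm _ hx) (chain_rev lc (hm _ lc)).
have [x' ex ch'] := chain_lift (ltW e0') ch.
have x'0 : x' = 0.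
  apply/eqP; rewrite -[_ == 0](expf_eq0 x' 2) //; apply/eqP; apply: (addIr c).
  by rewrite add0r -[RHS]ex.
have -> : level k.+1 r = quad c @^-1` level k r.
  by apply/seteqP; split=> z; rewrite levelS_quad.
by rewrite -{1}x'0.
Qed.
End Levels.

(** * Separation of the two inverse branches *)

Section Branch.
Variables (R : realType) (c : Cplx R) (n : nat) (r1 r2 : R).
Hypotheses (hr : cmod c + 3 <= r1) (h12 : r1 < r2) (hcrit : r2 < cmod (iter n (quad c) c)).
Variable T : Cplx R -> Cplx R.
Hypothesis hT : forall z, level c n r2 z -> quad c (T z) = z.
Hypothesis hcont : forall z, level c n r2 z -> forall e : R, 0 < e ->
  exists2 d : R, 0 < d & forall y, cmod (y - z) < d -> cmod (T y - T z) < e.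
Implicit Types x y z : Cplx R.

Let hr2 : cmod c + 3 <= r2. Proof. exact: le_trans (ltW h12). Qed.

Lemma branch_sqr z : level c n r2 z -> T z ^+ 2 = z - c.
Proof. by move/hT => {2}<-; rewrite /quad addrK. Qed.

(** [|T z| ^ 2 = |z - c|], and [c] lies outside the larger level set. *)
Lemma branch_lower : exists2 k0 : R, 0 < k0 & forall z, level c n r2 z -> k0 <= cmod (T z).
Proof.
have [L L0 hL] := iter_quad_lipschitz c n r2.
pose g : R := (cmod (iter n (quad c) c) - r2) / L.
have g0 : 0 < g by rewrite divr_gt0 // subr_gt0.
exists (Num.sqrt g); first by rewrite sqrtr_gt0.
move=> z hz; rewrite -[leRHS]ger0_norm ?cmod_ge0 // -sqrtr_sqr.
apply: ler_wsqrtr; rewrite -cmodX branch_sqr // /g ler_pdivrMr //.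
have cr : cmod c <= r2 by move: hr2; lra.
have := hL _ _ cr (level_norm hr2 hz).
have := cmod_triB (iter n (quad c) c) (iter n (quad c) z).
rewrite /level /= in hz; rewrite [cmod (c - z)]cmodB mulrC; lra.
Qed.

(** A square root is determined up to sign, and its sign cannot jump along a
    short segment: a point where [T p] is equally far from [T x] and [- T x]
    would satisfy [|T p - T x| ^ 2 = |p - x|], less than the square of the
    lower bound of [|T|].  This is where continuity of the branch is used. *)
Lemma branch_no_jump : exists2 e : R, 0 < e & exists2 k0 : R, 0 < k0 &
  forall x y, level c n r1 x -> cmod (y - x) <= e -> k0 <= cmod (T x + T y).
Proof.
have [k0 k00 hk] := branch_lower.
have [d d0 hd] := @level_thicken R c n r1 r2 hr2 h12.
exists (Num.min d (k0 ^+ 2 / 2)); first by rewrite lt_min d0 divr_gt0 // exprn_gt0.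
exists k0 => // x y hx; rewrite le_min => /andP[yd yk].
pose p (s : R) := x + rc s * (y - x).
have pd (s : R) : 0 <= s <= 1 -> cmod (p s - x) <= cmod (y - x).
  move=> /andP[s0 s1]; rewrite /p addrC addKr cmodM cmod_rc ger0_norm //.
  by rewrite ler_piMl // cmod_ge0.
have pE s : 0 <= s <= 1 -> level c n r2 (p s).
  by move=> hs; apply: hd hx _; apply: le_trans (pd _ hs) yd.
have xE : level c n r2 x by apply: hd hx _; rewrite subrr cmod0 ltW.
pose g (s : R) := cmod (T (p s) - T x) - cmod (T (p s) + T x).
have gc : {within `[0, 1], continuous g}.
  apply: continuous_in_subspaceT => s; rewrite inE /= in_itv /= => hs.
  apply/cvgrPdist_lt => e e0.
  have e20 : 0 < e / 2 by rewrite divr_gt0.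
  have [t t0 ht] := hcont (pE _ hs) e20.
  have D0 : 0 < cmod (y - x) + 1 by rewrite ltr_wpDl // cmod_ge0.
  apply/nbhs_ballP; exists (t / (cmod (y - x) + 1)); first by rewrite /= divr_gt0.
  move=> u /=; rewrite /ball /= ltr_pdivlMr // => hu.
  have pu : cmod (p u - p s) < t.
    rewrite /p (_ : _ - _ = rc (u - s) * (y - x)); last by rewrite rcB; ring.
    rewrite cmodM cmod_rc distrC; apply: le_lt_trans hu.
    by rewrite ler_wpM2l // lerDl.
  have := ht _ pu; rewrite /g.
  have := cmodB_trans (T (p u)) (T (p s)) (T x).
  have := cmodB_trans (T (p s)) (T (p u)) (T x).
  have := cmodB_trans (T (p u)) (T (p s)) (- T x).
  have := cmodB_trans (T (p s)) (T (p u)) (- T x).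
  rewrite !opprK [cmod (T (p s) - T (p u))]cmodB.
  move=> a1 a2 a3 a4 a5; rewrite ltr_norml; apply/andP; split; lra.
have p0 : p 0 = x by rewrite /p rc0 mul0r addr0.
have p1 : p 1 = y by rewrite /p rc1 mul1r addrC subrK.
have g0 : g 0 < 0.
  rewrite /g p0 subrr cmod0 sub0r oppr_lt0 -mulr2n -mulr_natl cmodM cmod_nat.
  by rewrite mulr_gt0 // (lt_le_trans k00) // hk.
have yE : level c n r2 y by rewrite -p1; apply: pE; rewrite ler01 lexx.
have dbl (u v : Cplx R) : 2 * cmod v <= cmod (u - v) + cmod (u + v).
  rewrite -(cmod_nat R 2) -cmodM (_ : 2%:R * v = (u + v) - (u - v)); last by ring.
  by apply: le_trans (cmodD _ _) _; rewrite cmodN addrC.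
have [g1|g1] := leP 0 (g 1); last first.
  have := dbl (T y) (T x); have := hk _ xE.
  move: g1; rewrite /g p1 [T x + T y]addrC; lra.
have [|s] := @IVT R g 0 1 0 ler01 gc.
  by rewrite ge_min (ltW g0) /= le_max g1 orbT.
rewrite in_itv /= => hs; rewrite /g => gs.
have e1 : cmod (T (p s) - T x) * cmod (T (p s) + T x) = cmod (p s - x).
  rewrite -cmodM -[in RHS](hT (pE _ hs)) -[in RHS](hT xE) quadB //.
have := pd _ hs; have := dbl (T (p s)) (T x); have := hk _ xE.
have {}gs : cmod (T (p s) - T x) = cmod (T (p s) + T x) by lra.
move: e1; rewrite gs -expr2 => <- h1 h2 h3.
have h4 : k0 <= cmod (T (p s) + T x) by lra.
have : k0 ^+ 2 <= cmod (T (p s) + T x) ^+ 2 by rewrite ler_pXn2r ?nnegrE ?cmod_ge0 // ltW.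
have : 0 < k0 ^+ 2 by rewrite exprn_gt0.
lra.
Qed.

(** Uniform separation of the two branches, [|T x - (- T y)| >= k0].  For
    distant points it follows from [(T y - T x) (T y + T x) = y - x], since
    [|T y - T x|] is bounded above. *)
Lemma branch_sum_lower : exists2 k0 : R, 0 < k0 &
  forall x y, level c n r1 x -> level c n r1 y -> k0 <= cmod (T x + T y).
Proof.
have [e e0 [k0 k00 hk]] := branch_no_jump.
have E12 z : level c n r1 z -> level c n r2 z.
  by rewrite /level /= => /le_trans; apply; exact: ltW.
have TB z : level c n r1 z -> cmod (T z) <= r1.
  move=> hz; apply: (@level_norm _ c n.+1) => //.
  by rewrite levelS_quad hT //; exact: E12.
have r10 : 0 < r1 by have := cmod_ge0 c; move: hr; lra.
exists (Num.min k0 (e / (2 * r1))).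
  by rewrite lt_min k00 divr_gt0 // mulr_gt0.
move=> x y hx hy; rewrite ge_min; have [h|h] := leP (cmod (y - x)) e.
  by rewrite hk.
apply/orP; right; rewrite ler_pdivrMr ?mulr_gt0 //.
apply: le_trans (ltW h) _.
have -> : y - x = (T y - T x) * (T y + T x).
  by rewrite -(quadB c) !hT //; exact: E12.
rewrite cmodM mulrC.
rewrite [T y + T x]addrC ler_wpM2l ?cmod_ge0 //.
by apply: le_trans (cmodD _ _) _; rewrite cmodN mulr_natl mulr2n lerD // TB.
Qed.
End Branch.

(** * Words of inverse branches contract *)

Section Words.
Variables (U : Type) (T1 T2 : U -> U).
Implicit Types (u v w : seq bool) (b : bool).

Definition letter_act b := if b then T2 else T1.

Lemma word_act_cat u v z :
  word_act T1 T2 (u ++ v) z = word_act T1 T2 u (word_act T1 T2 v z).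
Proof. by rewrite /word_act foldr_cat. Qed.

Lemma word_act_stable (A : set U) w z : (forall b z, A z -> A (letter_act b z)) ->
  A z -> A (word_act T1 T2 w z).
Proof. by move=> TA Az; elim: w => //= b w IH; exact: TA. Qed.
End Words.

(** The branches map E strictly inside itself: a neighbourhood of fixed size [d]
    of each image [Tb b z] stays in E.  Hence, for small [t], E is still stable
    after each letter is expanded by a factor [1 + t] about the orbit of a given
    point [x].  At [x] the expanded word has derivative [(1 + t) ^ |w|] times
    that of the word, and Cauchy's estimate bounds it independently of [w].
    This is the argument of Earle and Hamilton for
    holomorphic maps of a bounded domain strictly inside itself. *)
Section Contraction.
Variables (R : realType) (c : Cplx R) (E : set (Cplx R)) (T1 T2 : Cplx R -> Cplx R).
Variables (B kappa d : R).
Implicit Types (x y z h : Cplx R) (w : seq bool) (b : bool).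

Local Notation Tb := (letter_act T1 T2).
Local Notation W := (word_act T1 T2).

Hypotheses (B0 : 0 < B) (kappa0 : 0 < kappa) (d0 : 0 < d).
Hypothesis EB : forall z, E z -> cmod z <= B.
Hypothesis quadT : forall b z, E z -> quad c (Tb b z) = z.
Hypothesis T_sum : forall b x y, E x -> E y -> kappa <= cmod (Tb b x + Tb b y).
Hypothesis T_thick : forall b z h, E z -> cmod h <= d -> E (Tb b z + h).
Hypothesis E0 : E 0.
Hypothesis E_chain : forall e : R, 0 < e ->
  exists m, forall x, E x -> chain E e m x 0.

Lemma letter_actE b z : E z -> E (Tb b z).
Proof. by move=> hz; rewrite -[Tb b z]addr0; apply: T_thick; rewrite ?cmod0 // ltW. Qed.

Lemma word_actE w z : E z -> E (W w z).
Proof. by apply: word_act_stable => b y; exact: letter_actE. Qed.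

Lemma letter_actB b x y : E x -> E y -> (Tb b x - Tb b y) * (Tb b x + Tb b y) = x - y.
Proof. by move=> hx hy; rewrite -(quadB c) !quadT. Qed.

Lemma letter_act_neq0 b x y : E x -> E y -> Tb b x + Tb b y != 0.
Proof. by move=> hx hy; rewrite -cmod_gt0 (lt_le_trans kappa0) // T_sum. Qed.

Lemma letter_act_lip b x y : E x -> E y -> cmod (Tb b x - Tb b y) <= cmod (x - y) / kappa.
Proof.
move=> hx hy; rewrite ler_pdivlMr // -(letter_actB b hx hy) cmodM.
by rewrite ler_wpM2l ?cmod_ge0 // T_sum.
Qed.

(** Complex differentiability with a uniform second order remainder.  Being a
    global condition on E, it is stable under composition whatever the shape
    of E. *)
Definition smooth_on (F F' : Cplx R -> Cplx R) := exists2 L : R, 0 <= L &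
  forall x y, E x -> E y ->
   [/\ cmod (F' x) <= L, cmod (F y - F x) <= L * cmod (y - x)
     & cmod (F y - F x - F' x * (y - x)) <= L * cmod (y - x) ^+ 2].

Lemma letter_act_smooth b : smooth_on (Tb b) (fun z => (2 * Tb b z)^-1).
Proof.
have k2 : 0 <= kappa^-1 by rewrite invr_ge0 ltW.
exists (kappa^-1 + kappa^-1 ^+ 3) => [|x y hx hy]; first by rewrite addr_ge0 ?exprn_ge0.
have k3 : 0 <= kappa^-1 ^+ 3 by rewrite exprn_ge0.
have s0 := letter_act_neq0 b hx hx; have s1 := letter_act_neq0 b hy hx.
have h1 : cmod (2 * Tb b x)^-1 <= kappa^-1.
  by rewrite cmodV mulr_natl mulr2n lef_pV2 ?posrE ?T_sum // cmod_gt0.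
have D : Tb b y - Tb b x = (y - x) / (Tb b y + Tb b x).
  by rewrite -(letter_actB b hy hx) mulfK.
have h2 : cmod (Tb b y + Tb b x)^-1 <= kappa^-1.
  by rewrite cmodV lef_pV2 ?posrE ?T_sum // cmod_gt0.
split.
- by apply: le_trans h1 _; rewrite lerDl.
- rewrite D cmodM mulrC; apply: ler_wpM2r; first exact: cmod_ge0.
  by apply: le_trans h2 _; rewrite lerDl.
have -> : Tb b y - Tb b x - (2 * Tb b x)^-1 * (y - x) =
    - ((Tb b y + Tb b x)^-1 ^+ 2 * (2 * Tb b x)^-1) * (y - x) ^+ 2.
  rewrite -mulr2n -mulr_natl in s0.
  have : y - x = (Tb b y - Tb b x) * (Tb b y + Tb b x) by rewrite letter_actB.
  move=> ->; field.
  by rewrite s1 andbT; move: s0; rewrite mulf_eq0 negb_or => /andP[].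
rewrite cmodM cmodN cmodM !cmodX; apply: ler_wpM2r; first by rewrite exprn_ge0 // cmod_ge0.
apply: le_trans (_ : kappa^-1 ^+ 3 <= _); last by rewrite lerDr.
rewrite [leRHS]exprSr; apply: ler_pM; rewrite ?exprn_ge0 ?cmod_ge0 //.
by rewrite ler_pXn2r ?nnegrE // cmod_ge0.
Qed.

Lemma smooth_on_comp F F' G G' : (forall x, E x -> E (G x)) ->
  smooth_on F F' -> smooth_on G G' -> smooth_on (F \o G) (fun z => F' (G z) * G' z).
Proof.
move=> GE [L L0 hF] [M M0 hG].
have M2 : 0 <= M ^+ 2 by rewrite exprn_ge0.
exists (L * (M ^+ 2 + M)); first by rewrite mulr_ge0 // addr_ge0.
move=> x y hx hy; have [f1 f2 f3] := hF _ _ (GE _ hx) (GE _ hy).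
have [g1 g2 g3] := hG _ _ hx hy.
have a0 := cmod_ge0 (y - x).
have LM : L * M <= L * (M ^+ 2 + M) by rewrite ler_wpM2l // lerDr.
split => /=.
- rewrite cmodM; apply: le_trans LM; apply: ler_pM; rewrite ?cmod_ge0 //.
- apply: le_trans f2 _; apply: le_trans (ler_wpM2l L0 g2) _.
  by rewrite mulrA ler_wpM2r.
have -> : F (G y) - F (G x) - F' (G x) * G' x * (y - x) =
  (F (G y) - F (G x) - F' (G x) * (G y - G x)) + F' (G x) * (G y - G x - G' x * (y - x)).
  by ring.
apply: le_trans (cmodD _ _) _; rewrite cmodM [in leRHS]mulrDr [leRHS]mulrDl.
apply: lerD.
  apply: le_trans f3 _; rewrite -mulrA; apply: ler_wpM2l => //.
  by rewrite -exprMn ler_pXn2r ?nnegrE ?cmod_ge0 // mulr_ge0.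
by rewrite -mulrA; apply: ler_pM; rewrite ?cmod_ge0.
Qed.

Lemma smooth_on_affine (a e : Cplx R) F F' :
  smooth_on F F' -> smooth_on (fun z => a * F z - e) (fun z => a * F' z).
Proof.
move=> [L L0 hF]; exists (cmod a * L); first by rewrite mulr_ge0 // cmod_ge0.
move=> x y hx hy; have [f1 f2 f3] := hF _ _ hx hy; split.
- by rewrite cmodM ler_wpM2l ?cmod_ge0.
- rewrite (_ : _ - _ = a * (F y - F x)); last by ring.
  by rewrite cmodM -mulrA ler_wpM2l ?cmod_ge0.
- rewrite (_ : _ - _ = a * (F y - F x - F' x * (y - x))); last by ring.
  by rewrite cmodM -mulrA ler_wpM2l ?cmod_ge0.
Qed.

(** The action of a word in which every letter is expanded by [1 + t] about
    the orbit of [x] under the unexpanded word. *)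
Fixpoint expand_word (t : R) x w z : Cplx R :=
  if w is b :: w' then rc (1 + t) * Tb b (expand_word t x w' z) - rc t * Tb b (W w' x) else z.

Fixpoint expand_deriv (t : R) x w z : Cplx R :=
  if w is b :: w' then rc (1 + t) * ((2 * Tb b (expand_word t x w' z))^-1 * expand_deriv t x w' z) else 1.

Lemma expand_wordE (t : R) x w z : 0 <= t -> t * (2 * B) <= d -> E x -> E z -> E (expand_word t x w z).
Proof.
move=> t0 td hx hz; elim: w => //= b w IH.
have -> : rc (1 + t) * Tb b (expand_word t x w z) - rc t * Tb b (W w x) =
   Tb b (expand_word t x w z) + rc t * (Tb b (expand_word t x w z) - Tb b (W w x)).
  by rewrite rcD rc1; ring.
apply: T_thick => //; rewrite cmodM cmod_rc ger0_norm //.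
apply: le_trans td; apply: ler_wpM2l => //.
apply: le_trans (cmodD _ _) _; rewrite cmodN mulr_natl mulr2n.
by apply: lerD; apply: EB; apply: letter_actE => //; exact: word_actE.
Qed.

Lemma expand_word_smooth (t : R) x w : 0 <= t -> t * (2 * B) <= d -> E x ->
  smooth_on (expand_word t x w) (expand_deriv t x w).
Proof.
move=> t0 td hx; elim: w => [|b w IH].
  exists 1 => // y z _ _; split; rewrite /= ?cmod1 ?mul1r //.
  by rewrite subrr cmod0 exprn_ge0 // cmod_ge0.
apply: (@smooth_on_affine _ _ (Tb b \o expand_word t x w)
  (fun z => (2 * Tb b (expand_word t x w z))^-1 * expand_deriv t x w z)).
apply: (smooth_on_comp _ (letter_act_smooth b) IH).
by move=> y; exact: expand_wordE.
Qed.

Lemma expand_word_center (t : R) x w : expand_word t x w x = W w x.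
Proof.
elim: w => //= b w ->; rewrite rcD rc1; rewrite -/(Tb b); ring.
Qed.

Lemma expand_word0 x w z : expand_word 0 x w z = W w z.
Proof. by elim: w => //= b w ->; rewrite addr0 mul1r mul0r subr0. Qed.

(** [expand_deriv 0 0 w] is the derivative of the word itself, as the expansion
    factor [1 + 0] makes all centres equivalent. *)
Lemma expand_deriv_center (t : R) x w :
  expand_deriv t x w x = rc ((1 + t) ^+ size w) * expand_deriv 0 0 w x.
Proof.
elim: w => [|b w IH]; first by rewrite /= mulr1.
rewrite /= IH expand_word_center expand_word0 exprS !rcM addr0 -/(rc 1) rc1; ring.
Qed.

Lemma word_deriv_bound (t r : R) x w : 0 <= t -> t * (2 * B) <= d -> 0 < r ->
  (forall h, cmod h <= r -> E (x + h)) ->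
  cmod (expand_deriv 0 0 w x) <= B / r * (1 + t)^-1 ^+ size w.
Proof.
move=> t0 td r0 hx.
have Ex : E x by rewrite -[x]addr0; apply: hx; rewrite cmod0 ltW.
have [L L0 hL] := expand_word_smooth w t0 td Ex.
have := @cauchy_estimate R (expand_word t x w) (expand_deriv t x w) x r L B r0 L0.
have t1 : 0 < (1 + t) ^+ size w by rewrite exprn_gt0 // ltr_wpDr.
rewrite expand_deriv_center cmodM cmod_rc ger0_norm ?(ltW t1) // => H.
rewrite exprVn ler_pdivlMr // mulrC; apply: H.
  move=> h k hh hk; have [_ _] := hL _ _ (hx _ hh) (hx _ hk).
  by rewrite [x + k]addrC addrKA.
by move=> h hh; apply: EB; apply: expand_wordE => //; exact: hx.
Qed.

(** Mean value inequality, by subdividing the segment ever more finely. *)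
Lemma smooth_segment_lipschitz F F' x y (M : R) : smooth_on F F' ->
  (forall s : R, 0 <= s <= 1 -> E (x + rc s * (y - x)) /\ cmod (F' (x + rc s * (y - x))) <= M) ->
  cmod (F y - F x) <= M * cmod (y - x).
Proof.
move=> [L L0 hL] hs.
set D := cmod (y - x); have D0 : 0 <= D by exact: cmod_ge0.
suff H m : cmod (F y - F x) <= M * D + L * D ^+ 2 / m.+1%:R.
  apply/ler_addgt0Pr => e e0.
  apply: le_trans (H (Num.truncn (L * D ^+ 2 / e))) _.
  rewrite lerD2l ler_pdivrMr // [leRHS]mulrC -ler_pdivrMr //; exact: ltW (truncnS_gt _).
pose p (j : nat) := x + rc (j%:R / m.+1%:R) * (y - x).
have m0 : 0 < m.+1%:R :> R by [].
have pj (j : nat) : (j <= m.+1)%N -> E (p j) /\ cmod (F' (p j)) <= M.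
  by move=> jm; apply: hs; rewrite divr_ge0 //= ler_pdivrMr // mul1r ler_nat.
have -> : F y - F x = \sum_(0 <= j < m.+1) (F (p j.+1) - F (p j)).
  rewrite telescope_sumr // /p mul0r mulfV ?gt_eqF // rc1 mul1r rc0 mul0r addr0.
  by congr (F _ - F _); rewrite addrC subrK.
apply: le_trans (cmod_sum _ _) _.
apply: le_trans (_ : \sum_(0 <= j < m.+1) (M * (D / m.+1%:R) + L * (D / m.+1%:R) ^+ 2) <= _).
  rewrite !big_mkord; apply: ler_sum => j _.
  have [Ej Mj] := pj j (ltnW (ltn_ord j)); have [Ej1 _] := pj j.+1 (ltn_ord j).
  have pB : p j.+1 - p j = rc (m.+1%:R^-1) * (y - x).
    rewrite /p -[j.+1]addn1 natrD mulrDl mul1r rcD; ring.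
  have cpB : cmod (p j.+1 - p j) = D / m.+1%:R.
    by rewrite pB cmodM cmod_rc ger0_norm ?invr_ge0 // mulrC.
  have [_ _ q3] := hL _ _ Ej Ej1; rewrite cpB in q3.
  have -> : F (p j.+1) - F (p j) = F' (p j) * (p j.+1 - p j) +
     (F (p j.+1) - F (p j) - F' (p j) * (p j.+1 - p j)) by ring.
  apply: le_trans (cmodD _ _) _; apply: lerD => //.
  rewrite cmodM cpB ler_wpM2r // divr_ge0 //.
rewrite big_mkord sumr_const card_ord -[leLHS]mulr_natl le_eqVlt; apply/orP; left.
by apply/eqP; field; rewrite gt_eqF.
Qed.

Lemma word_act_chain m (e C : R) b w x y : 0 <= C ->
  (forall p q, E p -> E q -> cmod (q - p) <= e -> cmod (W w (Tb b q) - W w (Tb b p)) <= C) ->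
  E x -> chain E e m x y -> cmod (W w (Tb b x) - W w (Tb b y)) <= m%:R * C.
Proof.
move=> C0 hC; elim: m x => [|m IH] x Ex /=; first by move=> ->; rewrite subrr cmod0 mul0r.
move=> [z [Ez hz hc]]; apply: le_trans (cmodB_trans _ (W w (Tb b z)) _) _.
rewrite -natr1 mulrDl mul1r [leRHS]addrC; apply: lerD; last exact: IH.
by rewrite cmodB; apply: hC.
Qed.

(** Uniform contraction.  The derivative bound holds near the images of the
    letters; the first letter to act moves E there, and chains of uniformly
    bounded length turn the local Lipschitz bound into a bound on diameters. *)
Lemma word_act_contracts : exists2 l : R, 0 <= l < 1 & exists2 C : R, 0 < C &
  forall w x y, E x -> E y -> cmod (W w x - W w y) <= C * l ^+ size w.
Proof.
pose t := d / (2 * B).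
have t0 : 0 < t by rewrite divr_gt0 // mulr_gt0.
have td : t * (2 * B) <= d by rewrite /t divfK // gt_eqF // mulr_gt0.
pose l := (1 + t)^-1.
have l0 : 0 < l by rewrite invr_gt0 ltr_wpDr // ltW.
have l1 : l < 1 by rewrite invf_lt1 ?ltrDl // ltr_wpDr // ltW.
exists l; first by rewrite (ltW l0) l1.
pose r := d / 2; have r0 : 0 < r by rewrite divr_gt0.
have rr : r + r = d by rewrite /r -splitr.
have [m hm] := E_chain (mulr_gt0 kappa0 r0).
pose C1 := B / r * r.
pose C := 2 * B + (2 * m%:R * C1) / l.
have C10 : 0 <= C1 by rewrite mulr_ge0 ?divr_ge0 // ltW.
have Cl : 0 <= 2 * m%:R * C1 / l.
  by apply: divr_ge0; [exact: mulr_ge0 (mulr_ge0 _ _) _|exact: ltW].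
exists C.
  by apply: ltr_wpDr => //; exact: mulr_gt0.
(* the letter [b] acts first *)
case/lastP => [|w b] x y Ex Ey.
  rewrite mulr1; apply: le_trans (cmodD _ _) _; rewrite cmodN.
  apply: le_trans (lerD (EB Ex) (EB Ey)) _.
  by rewrite /C mulr_natl mulr2n lerDl.
rewrite size_rcons -cats1 !word_act_cat /= -/(Tb b).
have C2 : 0 <= C1 * l ^+ size w by rewrite mulr_ge0 // exprn_ge0 // ltW.
have st p q : E p -> E q -> cmod (q - p) <= kappa * r ->
    cmod (W w (Tb b q) - W w (Tb b p)) <= C1 * l ^+ size w.
  move=> Ep Eq pq.
  have pq' : cmod (Tb b q - Tb b p) <= r.
    by apply: le_trans (letter_act_lip _ Eq Ep) _; rewrite ler_pdivrMr // mulrC.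
  have sm := expand_word_smooth w (lexx 0) _ E0; rewrite mul0r in sm; have {}sm := sm (ltW d0).
  have := @smooth_segment_lipschitz _ _ (Tb b p) (Tb b q) (B / r * l ^+ size w) sm.
  rewrite !expand_word0 => H.
  apply: le_trans (H _) _; last first.
    rewrite /C1 [leRHS]mulrAC; apply: ler_wpM2l => //.
    by apply: mulr_ge0; [exact: divr_ge0 (ltW B0) (ltW r0)|exact: exprn_ge0 (ltW l0)].
  move=> s /andP[s0 s1].
  have hs : cmod (rc s * (Tb b q - Tb b p)) <= r.
    rewrite cmodM cmod_rc ger0_norm //; apply: le_trans pq'.
    by rewrite ler_piMl // cmod_ge0.
  split; first by apply: T_thick => //; apply: le_trans hs _; rewrite -rr lerDl ltW.
  apply: (@word_deriv_bound t r) => //; first exact: ltW.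
  move=> h hh; rewrite -addrA; apply: T_thick => //.
  by apply: le_trans (cmodD _ _) _; rewrite -rr; exact: lerD.
have hx := word_act_chain C2 st Ex (hm _ Ex).
have hy := word_act_chain C2 st Ey (hm _ Ey).
apply: le_trans (cmodB_trans _ (W w (Tb b 0)) _) _.
rewrite [X in _ + X]cmodB; apply: le_trans (lerD hx hy) _.
have -> : C * l ^+ (size w).+1 = 2 * B * l ^+ (size w).+1 + 2 * m%:R * (C1 * l ^+ size w).
  by rewrite /C exprS; field; rewrite gt_eqF.
have : 0 <= 2 * B * l ^+ (size w).+1.
  by rewrite !mulr_ge0 ?exprn_ge0 ?(ltW l0) ?(ltW B0).
lra.
Qed.

End Contraction.

(** * Bounded distortion *)

(** Since [Tb b X - Tb b Y] is [X - Y] divided by [Tb b X + Tb b Y], the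
    difference quotient of a word is the inverse of a product of such sums.  Two
    of these products agree factor by factor up to the diameters of the intermediate
    images, whose sum is bounded by a geometric series. *)
Section Distortion.
Variables (R : realType) (c : Cplx R) (E : set (Cplx R)) (T1 T2 : Cplx R -> Cplx R).
Variables (kappa C l : R).
Implicit Types (x y z : Cplx R) (w : seq bool) (b : bool).
Local Notation Tb := (letter_act T1 T2).
Local Notation W := (word_act T1 T2).
Hypotheses (kappa0 : 0 < kappa) (C0 : 0 < C) (l01 : 0 <= l < 1).
Hypothesis quadT : forall b z, E z -> quad c (Tb b z) = z.
Hypothesis TE : forall b z, E z -> E (Tb b z).
Hypothesis T_sum : forall b x y, E x -> E y -> kappa <= cmod (Tb b x + Tb b y).
Hypothesis contr : forall w x y, E x -> E y -> cmod (W w x - W w y) <= C * l ^+ size w.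

Let A := 2 * C / kappa.

Lemma word_act_distortion_size w x y x' y' : E x -> E y -> E x' -> E y' ->
  cmod (W w x - W w y) * cmod (x' - y') <=
    expR (A * (1 - l ^+ size w) / (1 - l)) * (cmod (W w x' - W w y') * cmod (x - y)).
Proof.
move=> hx hy hx' hy'.
have WE w' z : E z -> E (W w' z) by apply: word_act_stable.
have A0 : 0 <= A by rewrite divr_ge0 ?mulr_ge0 // ltW.
have /andP[l0 l1] := l01.
elim: w => [|b w IH]; first by rewrite subrr mulr0 mul0r expR0 mul1r mulrC.
set X := W w x; set Y := W w y; set X' := W w x'; set Y' := W w y'.
rewrite -/X -/Y -/X' -/Y' in IH.
have [EX EY EX' EY'] : [/\ E X, E Y, E X' & E Y'] by split; exact: WE.
have D u v : E u -> E v -> cmod (Tb b u - Tb b v) * cmod (Tb b u + Tb b v) = cmod (u - v).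
  by move=> hu hv; rewrite -cmodM -(quadB c) !quadT.
have dXY := D _ _ EX EY; have dXY' := D _ _ EX' EY'.
have s0 := T_sum b EX EY; have s0' := T_sum b EX' EY'.
set S := cmod (Tb b X + Tb b Y) in dXY s0; set S' := cmod (Tb b X' + Tb b Y') in dXY' s0'.
rewrite [W _ x]/= [W _ y]/= [W _ x']/= [W _ y']/= -/X -/Y -/X' -/Y' -/(Tb b).
set U := cmod (_ - _) in dXY *; set U' := cmod (Tb b X' - Tb b Y') in dXY' *.
have S00 : 0 < S by exact: lt_le_trans s0.
have S00' : 0 < S' by exact: lt_le_trans s0'.
have U0 : 0 <= U by exact: cmod_ge0.
have U0' : 0 <= U' by exact: cmod_ge0.
(* the new factor of the two products, compared through the contraction bound *)
have hS : S' <= S * (1 + A * l ^+ size w).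
  have h1 : S' - S <= 2 * C * l ^+ size w.
    apply: le_trans (cmod_triB _ _) _.
    rewrite (_ : _ - _ = (Tb b X' - Tb b X) + (Tb b Y' - Tb b Y)); last by ring.
    apply: le_trans (cmodD _ _) _.
    have := contr (b :: w) hx' hx; have := contr (b :: w) hy' hy.
    rewrite /= -/X -/Y -/X' -/Y' -/(Tb b).
    have : C * l ^+ (size w).+1 <= C * l ^+ size w.
      by rewrite ler_pM2l // exprS ler_piMl ?exprn_ge0 // ltW.
    lra.
  have h2 : 2 * C * l ^+ size w <= S * (A * l ^+ size w).
    rewrite mulrA ler_wpM2r ?exprn_ge0 // /A mulrA ler_pdivlMr // mulrC.
    by rewrite ler_wpM2r // mulr_ge0 // ltW.
  lra.
have hK : expR (A * (1 - l ^+ size w) / (1 - l)) * (1 + A * l ^+ size w) <=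
    expR (A * (1 - l ^+ (size w).+1) / (1 - l)).
  rewrite (_ : A * (1 - l ^+ (size w).+1) / (1 - l) =
     A * (1 - l ^+ size w) / (1 - l) + A * l ^+ size w).
    by rewrite expRD ler_pM2l ?expR_gt0 // expR_ge1Dx.
  by rewrite exprS; field; rewrite subr_eq0 gt_eqF.
rewrite /= -/(size w).
set K1 := expR _ in IH hK; set K2 := expR _ in hK *.
have K10 : 0 <= K1 by exact: expR_ge0.
have p0 := cmod_ge0 (x - y); have p0' := cmod_ge0 (x' - y').
move: IH hK hS; rewrite -dXY -dXY'.
move: (1 + A * l ^+ size w) (cmod (x - y)) (cmod (x' - y')) p0 p0' => q p p' p0 p0' h1 h2 h3.
rewrite -(ler_pM2l S00).
apply: le_trans (_ : K1 * (U' * S' * p) <= _); first by rewrite [leLHS]mulrCA [leLHS]mulrA.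
apply: le_trans (_ : K1 * (U' * (S * q) * p) <= _).
  by apply: ler_wpM2l => //; apply: ler_wpM2r => //; apply: ler_wpM2l.
have -> : K1 * (U' * (S * q) * p) = S * ((K1 * q) * (U' * p)) by ring.
by apply: ler_wpM2l; [exact: ltW|apply: ler_wpM2r => //; exact: mulr_ge0].
Qed.

Lemma word_act_distortion : exists2 K : R, 1 <= K & forall w x y x' y',
  E x -> E y -> E x' -> E y' ->
  cmod (W w x - W w y) * cmod (x' - y') <= K * (cmod (W w x' - W w y') * cmod (x - y)).
Proof.
have A0 : 0 <= A by rewrite divr_ge0 ?mulr_ge0 // ltW.
have /andP[l0 l1] := l01; have l1' : 0 < 1 - l by rewrite subr_gt0.
exists (expR (A / (1 - l))).
  by rewrite -[leLHS](expR0 R) ler_expR; apply: divr_ge0 => //; exact: ltW.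
move=> w x y x' y' hx hy hx' hy'.
apply: le_trans (word_act_distortion_size w hx hy hx' hy') _.
apply: ler_wpM2r; first by rewrite mulr_ge0 ?cmod_ge0.
rewrite ler_expR ler_pdivrMr // divfK ?gt_eqF // ler_piMr //.
by rewrite gerBl exprn_ge0.
Qed.
End Distortion.

(** * Sums over words *)

Section WordSums.
Variable R : realType.
Implicit Types (w u v : seq bool) (g h : seq bool -> R).

Fixpoint words n : seq (seq bool) :=
  if n is n'.+1 then [seq false :: w | w <- words n'] ++ [seq true :: w | w <- words n']
  else [:: [::]].

Lemma mem_words n w : (w \in words n) = (size w == n).
Proof.
elim: n w => [|n IH] [|b w] //=; rewrite mem_cat.
  by apply/negbTE; rewrite negb_or; apply/andP; split; apply/mapP => -[].
rewrite eqSS -IH; apply/orP/idP => [[] /mapP[w' hw' [_ ->]] //|hw].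
by case: b; [right|left]; apply/mapP; exists w.
Qed.

Lemma words_uniq n : uniq (words n).
Proof.
elim: n => //= n IH; rewrite cat_uniq !map_inj_uniq ?IH ?andbT //=; try by move=> ? ? [].
by apply/hasPn => w /mapP[w' _ ->]; apply/mapP => -[].
Qed.

Lemma sum_words_add n m g :
  \sum_(w <- words (n + m)) g w = \sum_(u <- words n) \sum_(v <- words m) g (u ++ v).
Proof.
elim: n g => [|n IH] g; first by rewrite big_seq1.
by rewrite addSn /= !big_cat !big_map /= !IH.
Qed.

Definition words_lt M := flatten [seq words j | j <- iota 0 M].

Lemma words_ltS M : words_lt M.+1 = words_lt M ++ words M.
Proof. by rewrite /words_lt -addn1 iotaD map_cat flatten_cat /= cats0. Qed.

Lemma mem_words_lt M w : (w \in words_lt M) = (size w < M)%N.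
Proof.
elim: M => [|M IH]; first by rewrite ltn0.
by rewrite words_ltS mem_cat IH mem_words ltnS [RHS]leq_eqVlt orbC.
Qed.

Lemma words_lt_uniq M : uniq (words_lt M).
Proof.
elim: M => // M IH; rewrite words_ltS cat_uniq IH words_uniq andbT /=.
by apply/hasPn => w; rewrite mem_words mem_words_lt => /eqP ->; rewrite ltnn.
Qed.

Lemma sum_words_lt M g : \sum_(w <- words_lt M) g w = \sum_(j < M) \sum_(w <- words j) g w.
Proof.
elim: M => [|M IH]; first by rewrite big_nil big_ord0.
by rewrite words_ltS big_cat /= IH big_ord_recr.
Qed.

Lemma ler_sum_image (I J : eqType) (s : seq I) (t : seq J) (f : J -> I) (h : I -> R) :
  (forall i, 0 <= h i) -> uniq s -> {subset s <= map f t} ->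
  \sum_(i <- s) h i <= \sum_(j <- t) h (f j).
Proof.
move=> h0; elim: t s => [|j t IH] s us st.
  by case: s us st => [|i s] _ st; rewrite ?big_nil //; have := st i (mem_head _ _).
rewrite big_cons; have [js|js] := boolP (f j \in s).
  rewrite (big_rem _ js) /= lerD2l; apply: IH; first exact: rem_uniq.
  move=> i; rewrite mem_rem_uniq // inE => /andP[ij /st].
  by rewrite /= inE (negbTE ij).
rewrite -[leLHS]add0r; apply: lerD => //; apply: IH => // i si.
by have := st i si; rewrite /= inE => /orP[/eqP ij|//]; rewrite -ij si in js.
Qed.

Lemma submul_words_pow (m : seq bool -> R) n k : (forall w, 0 <= m w) ->
  (forall u v, m (u ++ v) <= m u * m v) ->
  \sum_(w <- words (n * k)) m w <= m [::] * (\sum_(w <- words n) m w) ^+ k.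
Proof.
move=> m0 mm; elim: k => [|k IH]; first by rewrite muln0 big_seq1 expr0 mulr1.
rewrite mulnS sum_words_add exprS.
apply: le_trans (_ : \sum_(u <- words n) m u * \sum_(v <- words (n * k)) m v <= _).
  by apply: ler_sum => u _; rewrite mulr_sumr; apply: ler_sum.
rewrite -mulr_suml mulrCA; apply: ler_wpM2l => //.
exact: sumr_ge0.
Qed.

(** Let the mass be submultiplicative.  If every word of length N starts with
    a code word and the code words have total mass at most 1/2, then the total
    mass is finite: splitting off a code word from every word of length at
    least N bounds the sum P over the words shorter than M by the sum over the
    words shorter than N plus P/2. *)
Lemma code_sum_bounded (m : seq bool -> R) (code : nat -> seq bool) N :
  (forall w, 0 <= m w) -> (forall u v, m (u ++ v) <= m u * m v) ->
  (forall v, size v = N -> exists k v', v = code k ++ v') ->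
  (forall n, \sum_(k < n) m (code k) <= 1 / 2) ->
  forall M, \sum_(w <- words_lt M) m w <= 2 * \sum_(w <- words_lt N) m w.
Proof.
move=> m0 mm hcode hsum M.
(* [k v] is the index of a code word at the start of [v]; 0 is a
   default for words of other lengths. *)
have [k hk] := choice (fun v : seq bool => (
  match pselect (size v = N) return (exists k : nat, size v = N -> exists v', v = code k ++ v') with
  | left e => let: ex_intro k h := hcode v e in ex_intro _ k (fun _ => h)
  | right e => ex_intro _ 0%N (fun e' => False_ind _ (e e')) end)).
pose kmax := (\max_(v <- words N) k v).+1.
set P := \sum_(w <- words_lt M) m w.
have P0 : 0 <= P by exact: sumr_ge0.
suff H : P <= \sum_(w <- words_lt N) m w + 1 / 2 * P by lra.
pose t := [seq (code i ++ v') | i <- iota 0 kmax, v' <- words_lt M].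
have hs : {subset words_lt M <= map id (words_lt N ++ t)}.
  move=> v; rewrite map_id mem_words_lt => vM; rewrite mem_cat mem_words_lt.
  have [//|Nv /=] := ltnP (size v) N.
  have sv : size (take N v) = N by rewrite size_takel.
  have [v' hv'] := hk _ sv.
  apply/allpairsP; exists (k (take N v), v' ++ drop N v); split.
  - rewrite mem_iota add0n /kmax ltnS /=.
    by rewrite (@leq_bigmax_seq _ _ _ _ (take N v)) // mem_words sv.
  - rewrite mem_words_lt /=; apply: leq_ltn_trans vM.
    by rewrite -{2}(cat_take_drop N v) hv' -catA !size_cat leq_addl.
  - by rewrite /= catA -hv' cat_take_drop.
have := @ler_sum_image _ _ _ (words_lt N ++ t) id m m0 (words_lt_uniq M) hs.
rewrite big_cat /= => /le_trans; apply; rewrite lerD2l.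
rewrite /t big_allpairs_dep /=.
apply: le_trans (_ : \sum_(i <- iota 0 kmax) (m (code i) * P) <= _).
  apply: ler_sum => i _; rewrite /P mulr_sumr; exact: ler_sum.
rewrite -mulr_suml ler_wpM2r //.
have -> : iota 0 kmax = index_iota 0 kmax by rewrite /index_iota subn0.
by rewrite big_mkord; exact: hsum.
Qed.
End WordSums.

(** * Hausdorff dimension and covers *)

Section HausdorffCovers.
Variable R : realType.
Implicit Types (U J : set (Cplx R)).

Lemma diameter_ge0 U : (0 <= diameter U)%E.
Proof. by apply: ereal_sup_ubound; left. Qed.

Lemma diameter_le U (r : R) : 0 <= r -> (forall x y, U x -> U y -> cmod (x - y) <= r) ->
  (diameter U <= r%:E)%E.
Proof.
move=> r0 h; apply: ge_ereal_sup => _ [->|[x Ux [y Uy <-]]]; first by rewrite lee_fin.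
by rewrite lee_fin h.
Qed.

Lemma le_diameter U (r : R) x y : (diameter U <= r%:E)%E -> U x -> U y -> cmod (x - y) <= r.
Proof.
move=> h Ux Uy; rewrite -lee_fin; apply: le_trans h.
by apply: ereal_sup_ubound; right; exists x => //; exists y.
Qed.

Lemma hausdorff_content_ge0 (delta d : R) J : (0 <= hausdorff_content delta d J)%E.
Proof.
apply: le_ereal_inf_tmp => _ [V _ <-]; apply: nneseries_ge0 => n _ _; exact: poweR_ge0.
Qed.

(** Dimension below 1 gives covers with arbitrarily small sum of diameters:
    [t <= t `^ d] for [0 <= t <= 1] and [d < 1]. *)
Lemma dim_lt1_covers J (e : R) : (hausdorff_dim J < 1)%E -> 0 < e ->
  exists (V : nat -> set (Cplx R)) (r : nat -> R),
  [/\ J `<=` \bigcup_k V k, forall k, 0 <= r k,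
      forall k x y, V k x -> V k y -> cmod (x - y) <= r k
    & forall n, \sum_(k < n) r k <= e].
Proof.
move=> /ereal_inf_lt[_ [d [d0 hd] <-]] d1 e0; rewrite lte_fin in d1.
have : (hausdorff_content 1 d J < e%:E)%E.
  apply: le_lt_trans (_ : (0 < e%:E)%E); last by rewrite lte_fin.
  by rewrite -hd; apply: ereal_sup_ubound; exists 1 => //=.
move=> /ereal_inf_lt[_ [V [cov diam] <-]] hsum.
have fin k : (diameter (V k) \is a fin_num)%E.
  rewrite fin_numE; apply/andP; split; apply/eqP => h.
    by have := diameter_ge0 (V k); rewrite h.
  by have := diam k; rewrite h.
pose r k := fine (diameter (V k)).
have rE k : diameter (V k) = (r k)%:E by rewrite /r fineK.
have r0 k : 0 <= r k by have := diameter_ge0 (V k); rewrite rE lee_fin.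
have r1 k : r k <= 1 by have := diam k; rewrite rE lee_fin.
exists V, r; split=> //.
  by move=> k x y; apply: le_diameter; rewrite rE.
move=> n; rewrite -lee_fin; apply: le_trans (ltW hsum).
apply: le_trans (nneseries_lim_ge n _) => //; last first.
  by move=> k _ _; exact: poweR_ge0.
rewrite -sumEFin big_mkord; apply: lee_sum => k _.
rewrite rE poweR_EFin lee_fin; have := r0 k; rewrite le_eqVlt => /predU1P[<-|rk].
  exact: powR_ge0.
by rewrite -[leLHS]powRr1 //; apply: ger_powR; rewrite ?rk ?r1 // ltW.
Qed.

(** Finite covers suffice for an upper bound on the dimension; they are
    completed by empty sets, of diameter 0. *)
Lemma dim_lt1_of_covers J (d : R) : 0 < d < 1 ->
  (forall e : R, 0 < e -> exists (I : choiceType) (s : seq I) (V : I -> set (Cplx R)) (r : I -> R),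
    [/\ forall z, J z -> exists2 i, i \in s & V i z,
        forall i, i \in s -> 0 <= r i <= e,
        forall i x y, V i x -> V i y -> cmod (x - y) <= r i
      & \sum_(i <- s) r i `^ d <= e]) ->
  (hausdorff_dim J < 1)%E.
Proof.
move=> /andP[d0 d1] H.
apply: le_lt_trans (_ : (d%:E < 1)%E); last by rewrite lte_fin.
apply: ereal_inf_lbound; exists d => //; split=> //.
apply/eqP; rewrite eq_le; apply/andP; split; last first.
  apply: le_trans (hausdorff_content_ge0 1 d J) _.
  by apply: ereal_sup_ubound; exists 1 => //=.
apply: ge_ereal_sup => _ [delta delta0 <-].
apply/lee_addgt0Pr => e e0; rewrite add0e.
have [I [s [V [r [cov hr hV hsum]]]]] := H (Num.min delta e) ltac:(by rewrite lt_min delta0 e0).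
apply: ge_ereal_inf.
pose Vn n := if onth s n is Some i then V i else set0.
pose rn n := if onth s n is Some i then r i else 0.
have onths n i : onth s n = Some i -> i \in s.
  by elim: s n {H cov hr hsum Vn rn} => [|j s IH] [|n] //=; rewrite inE; [case=> ->; rewrite eqxx|move/IH ->; rewrite orbT].
have rn0 n : 0 <= rn n <= Num.min delta e.
  rewrite /rn; case E : (onth s n) => [i|]; first exact/hr/(onths _ _ E).
  by rewrite lexx le_min !ltW.
have diamn n : (diameter (Vn n) <= (rn n)%:E)%E.
  apply: diameter_le; first by case/andP: (rn0 n).
  by rewrite /Vn /rn; case: (onth s n) => [i|] x y //; exact: hV.
exists (\sum_(0 <= k <oo) diameter (Vn k) `^ d)%E.
  exists Vn => //; split.
    move=> z /cov[i si Vz]; exists (index i s) => //; rewrite /Vn.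
    have -> : onth s (index i s) = Some i; last by [].
    elim: s si {H cov hr hsum Vn rn onths rn0 diamn} => //= j s IH; rewrite inE eq_sym.
    by case: eqP => [->|_] //= /IH.
  move=> k; apply: le_trans (diamn k) _; rewrite lee_fin.
  by have /andP[_] := rn0 k; rewrite le_min => /andP[].
rewrite (@nneseries_split _ _ 0 (size s)); last by move=> k _; exact: poweR_ge0.
rewrite [X in (_ + X)%E]eseries0 ?adde0; last first.
  move=> k hk _; have : (diameter (Vn k) <= 0)%E.
    apply: diameter_le => // x y; rewrite /Vn.
    have -> // : onth s k = None.
    elim: s k hk {H cov hr hsum Vn rn onths rn0 diamn} => [|j s IH] [|k] //=.
    by rewrite !add0n ltnS; exact: IH.
  move=> h; have -> : diameter (Vn k) = 0%E by apply/eqP; rewrite eq_le h diameter_ge0.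
  by rewrite poweR0r // gt_eqF.
apply: le_trans (_ : (\sum_(0 <= k < 0 + size s) (rn k `^ d)%:E <= _)%E).
  apply: lee_sum => k _; rewrite -poweR_EFin; apply: gt0_ler_poweR => //; rewrite ?(ltW d0) //.
  - by rewrite in_itv /= diameter_ge0 leey.
  - by rewrite in_itv /= leey andbT lee_fin; case/andP: (rn0 k).
rewrite sumEFin lee_fin add0n.
have -> : \sum_(0 <= k < size s) rn k `^ d = \sum_(i <- s) r i `^ d.
  rewrite /rn; elim: s {H cov hr hsum Vn rn onths rn0 diamn} => [|j s IH] /=; first by rewrite big_nil big_geq.
  by rewrite big_nat_recl // big_cons /= IH.
by apply: le_trans hsum _; rewrite ge_min lexx orbT.
Qed.

Lemma absolutely_convergent_words (f : seq bool -> Cplx R) :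
  absolutely_convergent f <-> exists B : R, forall M, \sum_(w <- words_lt M) cmod (f w) <= B.
Proof.
have f0 w : (0 <= (cmod (f w))%:E)%E by rewrite lee_fin cmod_ge0.
rewrite /absolutely_convergent; split.
  move=> fin; set S := (\esum_(i in [set: seq bool]) (cmod (f i))%:E)%E in fin.
  have S0 : (0 <= S)%E by exact: esum_ge0.
  exists (fine S) => M; rewrite -lee_fin fineK; last by rewrite ge0_fin_numE.
  apply: esum_ge; exists [set` words_lt M]; first by split=> //; exact: finite_seq.
  by rewrite -sumEFin fsbig_seq ?words_lt_uniq.
move=> [B hB]; apply: le_lt_trans (ltry B).
apply: ge_ereal_sup => _ [A [finA _] <-].
rewrite fsbig_finite //= sumEFin lee_fin.
set s := (finmap.enum_fset (fset_set A)).
apply: le_trans (hB (\max_(w <- s) size w).+1).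
apply: (@ler_sum_image _ _ _ _ _ id).
- by move=> w; exact: cmod_ge0.
- exact: finmap.fset_uniq.
- by move=> w ws; rewrite map_id mem_words_lt ltnS; apply: leq_bigmax_seq.
Qed.
End HausdorffCovers.

(** * Dimension of the limit set *)

(** Continuity in the exponent lets the exponent 1 drop a little. *)
Lemma powR_sum_lt1 (R : realType) (I : Type) (s : seq I) (a : I -> R) :
  (forall i, 0 < a i) -> \sum_(i <- s) a i < 1 ->
  exists2 d : R, 0 < d < 1 & \sum_(i <- s) a i `^ d < 1.
Proof.
move=> a0 s1.
have cv : (fun d => \sum_(i <- s) a i `^ d) @ (1 : R) --> \sum_(i <- s) a i.
  elim: s {s1} => [|i s IH].
    under eq_fun do rewrite big_nil.
    by rewrite big_nil; exact: cvg_cst.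
  under eq_fun do rewrite big_cons.
  rewrite big_cons; apply: cvgD => //.
  rewrite -[X in _ --> X](powRr1 (ltW (a0 i))).
  rewrite /powR; case: eqP => [e|_]; first by have := a0 i; rewrite e ltxx.
  apply: (@continuous_comp _ _ _ (fun d : R => d * ln (a i)) (@expR R)).
    exact: mulrr_continuous.
  exact: continuous_expR.
have e0 : 0 < 1 - \sum_(i <- s) a i by rewrite subr_gt0.
have /cvgrPdist_lt /(_ _ e0) /nbhs_ballP [t /= t0 ht] := cv.
have h0 : 0 < Num.min (t / 2) (1 / 2) by rewrite lt_min !divr_gt0.
have h1 : Num.min (t / 2) (1 / 2) <= 1 / 2 by rewrite ge_min lexx orbT.
have h2 : Num.min (t / 2) (1 / 2) <= t / 2 by rewrite ge_min lexx.
exists (1 - Num.min (t / 2) (1 / 2)); first by apply/andP; split; lra.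
have := ht (1 - Num.min (t / 2) (1 / 2)); rewrite /ball /= => /(_ _).
rewrite opprB addrCA subrr addr0 gtr0_norm //.
have h3 : Num.min (t / 2) (1 / 2) < t by lra.
by move=> /(_ h3); rewrite ltr_distlC; lra.
Qed.

(** J is the limit set of two maps of E with disjoint images, whose words
    contract with bounded distortion.  The points [a1], [a2] only serve to measure the size of
    the cylinder of a word [w] by [|w a1 - w a2|]. *)
Section LimitSet.
Variables (R : realType) (E J : set (Cplx R)) (T1 T2 : Cplx R -> Cplx R).
Variables (C l K kappa : R) (a1 a2 p0 : Cplx R).
Implicit Types (x y z : Cplx R) (u v w : seq bool) (b : bool).
Local Notation Tb := (letter_act T1 T2).
Local Notation W := (word_act T1 T2).

Hypotheses (C0 : 0 < C) (l01 : 0 <= l < 1) (K1 : 1 <= K) (kappa0 : 0 < kappa).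
Hypothesis TE : forall b z, E z -> E (Tb b z).
Hypothesis T_inj : forall b x y, E x -> E y -> Tb b x = Tb b y -> x = y.
Hypothesis T_sep : forall x y, E x -> E y -> kappa <= cmod (T1 x - T2 y).
Hypothesis contr : forall w x y, E x -> E y -> cmod (W w x - W w y) <= C * l ^+ size w.
Hypothesis distort : forall w x y x' y', E x -> E y -> E x' -> E y' ->
  cmod (W w x - W w y) * cmod (x' - y') <= K * (cmod (W w x' - W w y') * cmod (x - y)).
Hypothesis JE : forall z, J z -> E z.
Hypothesis TJ : forall b z, J z -> J (Tb b z).
Hypothesis J_split : forall z, J z -> exists b y, J y /\ z = Tb b y.
Hypothesis J_closed : forall z, (forall e : R, 0 < e -> exists2 y, J y & cmod (y - z) <= e) -> J z.
Hypotheses (Jp0 : J p0) (Ea1 : E a1) (Ea2 : E a2) (a12 : a1 != a2).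

Let D := cmod (a1 - a2).
Let D0 : 0 < D. Proof. by rewrite cmod_gt0 subr_eq0. Qed.
Let K0 : 0 < K. Proof. exact: lt_le_trans K1. Qed.

(** The normalization by the distortion constant makes the mass exactly
    submultiplicative. *)
Definition mass w := K / D * cmod (W w a1 - W w a2).

Let WE w z : E z -> E (W w z). Proof. exact: word_act_stable. Qed.
Let WJ w z : J z -> J (W w z). Proof. exact: word_act_stable. Qed.

Lemma mass_ge0 w : 0 <= mass w.
Proof. by rewrite mulr_ge0 ?cmod_ge0 // divr_ge0 // ltW. Qed.

Lemma mass_gt0 w : 0 < mass w.
Proof.
rewrite mulr_gt0 ?divr_gt0 // cmod_gt0 subr_eq0.
elim: w => //= b w; apply: contra_neq => h.
exact: (@T_inj b _ _ (WE w Ea1) (WE w Ea2) h).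
Qed.

Lemma word_act_mass w x y : E x -> E y -> cmod (W w x - W w y) <= mass w * cmod (x - y).
Proof.
move=> hx hy; have h := distort w hx hy Ea1 Ea2.
rewrite /mass -mulrA [_ / D * _]mulrAC ler_pdivlMr //.
Qed.

Lemma mass_word_act w x y : E x -> E y -> mass w * cmod (x - y) <= K ^+ 2 * cmod (W w x - W w y).
Proof.
move=> hx hy; have h := distort w Ea1 Ea2 hx hy.
rewrite /mass -mulrA [_ / D * _]mulrAC ler_pdivrMr // expr2 -!mulrA ler_pM2l //.
Qed.

Lemma mass_cat u v : mass (u ++ v) <= mass u * mass v.
Proof.
rewrite {1}/mass !word_act_cat [mass v]/mass mulrCA ler_pM2l ?divr_gt0 //.
exact: word_act_mass (WE _ Ea1) (WE _ Ea2).
Qed.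

Lemma mass_small (e : R) : 0 < e -> exists n, forall w, (n <= size w)%N -> mass w <= e.
Proof.
move=> e0; have [N hN] := geometric_small (K / D * C) l01 e0.
exists N => w /hN /ltW; apply: le_trans.
by rewrite -mulrA; apply: ler_wpM2l; [rewrite divr_ge0 // ltW|exact: contr].
Qed.

Lemma limit_set_code n z : J z -> exists w y, [/\ size w = n, J y & z = W w y].
Proof.
elim: n z => [|n IH] z hz; first by exists [::], z.
have [b [y [hy ->]]] := J_split hz.
by have [w [y' [sw hy' ->]]] := IH _ hy; exists (b :: w), y'; split=> //=; rewrite sw.
Qed.

Lemma letter_act_sep b b' x y : E x -> E y -> b != b' -> kappa <= cmod (Tb b x - Tb b' y).
Proof.
move=> hx hy; case: b; case: b' => // _; last exact: T_sep.
by rewrite cmodB; exact: T_sep.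
Qed.

Lemma word_act_code_inj u v x y : E x -> E y -> size u = size v -> W u x = W v y -> u = v.
Proof.
move=> hx hy; elim: u v => [|b u IH] [|b' v] //= [suv] h.
have bb : b = b'.
  apply/eqP; apply: contraT => /(letter_act_sep (WE u hx) (WE v hy)).
  by rewrite /letter_act h subrr cmod0 leNgt kappa0.
rewrite -bb in h *; congr (_ :: _); apply: IH => //.
exact: (@T_inj b _ _ (WE u hx) (WE v hy) h).
Qed.

Definition cylinder w : set (Cplx R) := [set z | exists2 y, J y & z = W w y].

(** A single cylinder of comparable size covers the trace of U on J: take the
    longest word whose cylinder contains that trace.  The trace then meets
    both children of the cylinder, so U is at least as large as the gap between
    them, which is comparable to the mass by bounded distortion.  The term [e]
    is for traces that do not split before the mass falls below [e]. *)
Lemma cover_by_cylinder (U : set (Cplx R)) (d e : R) : 0 <= d -> 0 < e ->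
  (forall x y, U x -> U y -> cmod (x - y) <= d) ->
  exists w, U `&` J `<=` cylinder w /\ mass w <= K ^+ 2 / kappa * d + e.
Proof.
move=> d0 e0 hU; have [n hn] := mass_small e0.
have kd : 0 <= K ^+ 2 / kappa * d.
  by rewrite mulr_ge0 // divr_ge0 ?(ltW kappa0) // exprn_ge0 // ltW.
have [[z0 [Uz0 Jz0]]|no] := pselect (exists z, U z /\ J z); last first.
  exists (nseq n false); split; first by move=> z [Uz Jz]; case: no; exists z.
  by have := hn (nseq n false); rewrite size_nseq leqnn => /(_ isT); lra.
have [w0 [y0 [sw0 Jy0 ez0]]] := limit_set_code n Jz0.
(* follow the code [w0] of [z0], which is long enough to have mass at most [e],
   until the trace splits *)
suff H v u : U `&` J `<=` cylinder u -> u ++ v = w0 ->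
    exists w, U `&` J `<=` cylinder w /\ (mass w <= K ^+ 2 / kappa * d \/ w = w0).
  have [|w [hw hm]] := H w0 [::] _ erefl; first by move=> z [_ Jz]; exists z.
  exists w; split=> //; case: hm => [hm| ->]; first lra.
  by have := hn w0; rewrite sw0 leqnn => /(_ isT); lra.
elim: v u => [|b v IH] u hu uv.
  by exists u; split=> //; right; rewrite -uv cats0.
have [hb|hb] := pselect (U `&` J `<=` cylinder (rcons u b)).
  by apply: IH hb _; rewrite cat_rcons.
exists u; split=> //; left.
have [z [[Uz Jz] nz]] : exists z, (U `&` J) z /\ ~ cylinder (rcons u b) z.
  by apply: contrapT => h; apply: hb => z hz; apply: contrapT => nz; apply: h; exists z.
have [y' Jy' ezy] := hu _ (conj Uz Jz).
have [b' [y'' [Jy'' eyy]]] := J_split Jy'.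
have bb : b != b'.
  apply/eqP => bb; apply: nz; exists y'' => //.
  by rewrite -cats1 word_act_cat /= -/(Tb b) bb -eyy.
have ez0' : z0 = W u (Tb b (W v y0)) by rewrite ez0 -uv word_act_cat.
have sep := letter_act_sep (WE v (JE Jy0)) (JE Jy'') bb.
have := @mass_word_act u (Tb b (W v y0)) (Tb b' y'').
rewrite -ez0' -eyy -ezy eyy => /(_ (TE _ (WE _ (JE Jy0))) (TE _ (JE Jy''))) h.
rewrite mulrAC ler_pdivlMr //.
apply: le_trans (ler_wpM2l (mass_ge0 u) sep) _; apply: le_trans h _.
by apply: ler_wpM2l; [rewrite exprn_ge0 // ltW|exact: hU].
Qed.

Lemma branch_point (om : nat -> bool) :
  exists2 z, J z & forall n, cmod (z - W (mkseq om n) p0) <= C * l ^+ n.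
Proof.
have [z hz] : exists z, forall n, cmod (z - W (mkseq om n) p0) <= C * l ^+ n.
  apply: (@cplx_complete R (fun n => W (mkseq om n) p0)).
    by rewrite -(mulr0 C); apply: cvgMr; apply: cvg_expr; move/andP: l01 => [? ?]; rewrite ger0_norm.
  move=> n m nm; have -> : mkseq om m = mkseq om n ++ mkseq (fun i => om (n + i)%N) (m - n).
    apply: (@eq_from_nth _ false); first by rewrite size_cat !size_mkseq subnKC.
    move=> i; rewrite size_mkseq => im; rewrite nth_cat size_mkseq nth_mkseq //.
    case: ltnP => ni; first by rewrite nth_mkseq.
    by rewrite nth_mkseq ?ltn_sub2r ?subnKC // (leq_ltn_trans ni).
  rewrite word_act_cat -[X in _ <= C * l ^+ X](size_mkseq om n).
  by apply: contr; [exact: WE (JE Jp0)|exact: JE].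
exists z => //; apply: J_closed => e e0.
have [N /(_ N (leqnn N)) hN] := geometric_small C l01 e0.
exists (W (mkseq om N) p0); first exact: WJ.
by rewrite cmodB; apply: le_trans (hz N) (ltW hN).
Qed.

Lemma branch_point_code (om : nat -> bool) : exists2 z, J z & forall n, cylinder (mkseq om n) z.
Proof.
have [z Jz hz] := branch_point om; exists z => // n.
have [y Jy hy] := branch_point (fun i => om (n + i)%N).
exists y => //; apply/eqP; rewrite -subr_eq0 -cmod_eq0 eq_le cmod_ge0 andbT.
apply/ler_addgt0Pr => e e0; rewrite add0r.
pose w := mkseq om n.
have [N /(_ N (leqnn N)) hN] := geometric_small ((1 + mass w) * C) l01 e0.
have e1 : W (mkseq om (n + N)) p0 = W w (W (mkseq (fun i => om (n + i)%N) N) p0).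
  by rewrite -word_act_cat /w /mkseq iotaD map_cat -[(0 + n)%N]addn0 iotaDl -map_comp.
apply: le_trans (ltW hN); apply: le_trans (cmodB_trans _ (W (mkseq om (n + N)) p0) _) _.
rewrite mulrDl mul1r mulrDl; apply: lerD.
  apply: le_trans (hz _) _; rewrite ler_pM2l // exprD ler_piMl //.
    by apply: exprn_ge0; case/andP: l01.
  by apply: exprn_ile1; case/andP: l01 => ? /ltW.
rewrite e1 -/w; apply: le_trans (word_act_mass _ (WE _ (JE Jp0)) (JE Jy)) _.
by rewrite -mulrA; apply: ler_wpM2l; [exact: mass_ge0|rewrite cmodB].
Qed.

(** Koenig's lemma: otherwise some infinite branch has no code word as a prefix,
    and the point of J that it codes is in no cylinder of the code. *)
Lemma finite_code (code : nat -> seq bool) : J `<=` \bigcup_k cylinder (code k) ->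
  exists N, forall v, size v = N -> exists k v', v = code k ++ v'.
Proof.
move=> cov; apply: contrapT => noN.
pose good v := exists k v', v = code k ++ v'.
have good_cat u v : good u -> good (u ++ v).
  by move=> [k [v' ->]]; exists k, (v' ++ v); rewrite catA.
pose P u := forall j, exists2 v, size v = j & ~ good (u ++ v).
have P0 : P [::].
  move=> j; apply: contrapT => h; apply: noN; exists j => v sv.
  by apply: contrapT => nv; apply: h; exists v.
have PS u : exists b, P u -> P (rcons u b).
  have [Pu|nPu] := pselect (P u); last by exists true.
  apply: contrapT => h.
  have H b : exists j, forall v, size v = j -> good (rcons u b ++ v).
    apply: contrapT => h'; apply: h; exists b => _ j.
    apply: contrapT => h''; apply: h'; exists j => v sv.
    by apply: contrapT => nv; apply: h''; exists v.
  have [j1 h1] := H false; have [j2 h2] := H true.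
  have [[|b v] // [sv] nv] := Pu (maxn j1 j2).+1; apply: nv.
  rewrite -cat_rcons -[v](cat_take_drop (if b then j2 else j1)) catA; apply: good_cat.
  by case: b; [apply: h2|apply: h1]; rewrite size_takel // sv (leq_maxl, leq_maxr).
have [g hg] := choice PS.
pose pre := fix pre n := if n is n'.+1 then rcons (pre n') (g (pre n')) else [::].
pose om n := g (pre n).
have preE n : pre n = mkseq om n by elim: n => //= n IH; rewrite mkseqS /om -IH.
have Ppre n : P (pre n) by elim: n => //= n IH; exact: hg.
have [z Jz hz] := branch_point_code om.
have [k _ [y Jy ezy]] := cov _ Jz.
have [y' Jy' ezy'] := hz (size (code k)).
have e : code k = mkseq om (size (code k)).
  apply: (word_act_code_inj (JE Jy) (JE Jy')); first by rewrite size_mkseq.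
  by rewrite -ezy -ezy'.
have [v] := Ppre (size (code k)) 0%N; move/eqP; rewrite size_eq0 => /eqP -> [].
by exists k, [::]; rewrite preE -e.
Qed.
(** Replacing a cover of small total diameter by cylinders gives a code of mass
    at most 1/2. *)
Lemma mass_sum_of_dim_lt1 : (hausdorff_dim J < 1)%E ->
  exists B : R, forall M, \sum_(w <- words_lt M) mass w <= B.
Proof.
move=> hdim; set A := K ^+ 2 / kappa.
have A0 : 0 < A by rewrite divr_gt0 // exprn_gt0.
have e0 : 0 < 1 / 4 / A :> R by rewrite divr_gt0.
have [V [r [cov r0 hV hsum]]] := dim_lt1_covers hdim e0.
(* the error terms of the single cylinders sum to at most 1/4 *)
have [code hcode] := choice (fun k =>
  @cover_by_cylinder (V k) (r k) (1 / 4 * 2^-1 ^+ k.+1) (r0 k)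
    ltac:(by rewrite mulr_gt0 // exprn_gt0) (hV k)).
have [|N hN] := @finite_code code _.
  move=> z Jz; have [k _ Vz] := cov _ Jz; exists k => //.
  by apply: (proj1 (hcode k)).
exists (2 * \sum_(w <- words_lt N) mass w).
apply: (code_sum_bounded mass_ge0 mass_cat hN) => n.
apply: le_trans (_ : \sum_(k < n) (A * r k + 1 / 4 * 2^-1 ^+ k.+1) <= _).
  by apply: ler_sum => k _; exact: (proj2 (hcode k)).
rewrite big_split /= -!mulr_sumr.
have g : \sum_(k < n) (2^-1 : R) ^+ k.+1 <= 1.
  have -> : \sum_(k < n) (2^-1 : R) ^+ k.+1 = 1 - 2^-1 ^+ n.
    elim: n => [|n IH]; first by rewrite big_ord0 expr0 subrr.
    by rewrite big_ord_recr /= IH exprS; lra.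
  by rewrite gerBl exprn_ge0.
have := ler_wpM2l (ltW A0) (hsum n).
have -> : A * (1 / 4 / A) = 1 / 4 by field; rewrite gt_eqF.
lra.
Qed.

(** Some level [n] has mass below 1, hence also below 1 with an exponent
    [d < 1]; by submultiplicativity the d-dimensional sum over the cylinders of
    level [n * k] decays geometrically in [k]. *)
Lemma dim_lt1_of_mass_sum :
  (exists B : R, forall M, \sum_(w <- words_lt M) mass w <= B) -> (hausdorff_dim J < 1)%E.
Proof.
move=> [B hB].
have [n hn] : exists n, \sum_(w <- words n) mass w <= 1 / 2.
  apply: contrapT => h.
  have H n : 1 / 2 <= \sum_(w <- words n) mass w.
    by apply: ltW; rewrite ltNge; apply/negP => h'; apply: h; exists n.
  have H' M : M%:R * (1 / 2) <= B.
    apply: le_trans (hB M); rewrite sum_words_lt.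
    apply: le_trans (_ : \sum_(j < M) (1 / 2 : R) <= _).
      by rewrite sumr_const card_ord -[leRHS]mulr_natl.
    by apply: ler_sum => j _.
  have := H' (Num.truncn (2 * B)).+1; have := truncnS_gt (2 * B); lra.
have n0 : (0 < n)%N.
  (* the empty word has mass [K >= 1] *)
  case: n hn => // h; exfalso; move: h; rewrite big_seq1 /mass /= -/D divfK ?gt_eqF //.
  by move: K1; lra.
have [|d d01 hd] := @powR_sum_lt1 R _ (words n) mass mass_gt0 _; first by lra.
have /andP[d0 d1] := d01.
set th := \sum_(w <- words n) mass w `^ d in hd.
have th0 : 0 <= th by apply: sumr_ge0 => w _; exact: powR_ge0.
apply: (dim_lt1_of_covers d01) => e e0.
have [k1 hk1] := @geometric_small R (C `^ d * mass [::] `^ d) th e ltac:(by rewrite th0 hd) e0.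
have [k2 hk2] := mass_small (divr_gt0 e0 C0).
pose k := maxn k1 k2.
exists (seq bool : choiceType), (words (n * k)), cylinder, (fun w => mass w * C); split.
- move=> z Jz; have [w [y [sw Jy ->]]] := limit_set_code (n * k) Jz.
  by exists w; [rewrite mem_words sw|exists y].
- move=> w; rewrite mem_words => /eqP sw.
  rewrite mulr_ge0 ?mass_ge0 ?(ltW C0) //= -ler_pdivlMr //.
  by apply: hk2; rewrite sw (leq_trans (leq_maxr k1 k2)) // leq_pmull.
- move=> w _ _ [x Jx ->] [y Jy ->].
  apply: le_trans (word_act_mass w (JE Jx) (JE Jy)) _.
  apply: ler_wpM2l; first exact: mass_ge0.
  by have := contr [::] (JE Jx) (JE Jy); rewrite /= mulr1.
apply: le_trans (ltW (hk1 k (leq_maxl _ _))); rewrite -mulrA.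
rewrite (eq_bigr (fun w => C `^ d * mass w `^ d)); last first.
  by move=> w _; rewrite powRM ?mass_ge0 ?(ltW C0) // mulrC.
rewrite -mulr_sumr; apply: ler_wpM2l; first exact: powR_ge0.
apply: (@submul_words_pow _ (fun w => mass w `^ d)) => [w|u v]; first exact: powR_ge0.
rewrite -powRM ?mass_ge0 //; apply: ge0_ler_powR; first exact: ltW.
- by rewrite nnegrE; exact: mass_ge0.
- by rewrite nnegrE; apply: mulr_ge0; exact: mass_ge0.
- exact: mass_cat.
Qed.

Theorem limit_set_dim_lt1 :
  (exists B : R, forall M, \sum_(w <- words_lt M) cmod (W w a1 - W w a2) <= B)
  <-> (hausdorff_dim J < 1)%E.
Proof.
have KD : 0 < K / D by rewrite divr_gt0.
rewrite (_ : (exists B : R, _) <-> exists B : R, forall M, \sum_(w <- words_lt M) mass w <= B).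
  by split; [exact: dim_lt1_of_mass_sum|exact: mass_sum_of_dim_lt1].
split=> -[B hB].
  exists (K / D * B) => M; rewrite /mass -mulr_sumr; apply: ler_wpM2l => //; exact: ltW.
by exists (B / (K / D)) => M; rewrite ler_pdivlMr // mulrC mulr_sumr; exact: hB.
Qed.
End LimitSet.

(** * The Julia set *)

Section FilledJulia.
Variables (R : realType) (c : Cplx R) (r : R).
Hypothesis hr : cmod c + 3 <= r.
Implicit Types z y : Cplx R.

(** Outside radius [r] the modulus at least doubles at each step; the linear
    growth recorded here is enough. *)
Lemma escape z k : r < cmod z -> cmod z + k%:R <= cmod (iter k (quad c) z).
Proof.
move=> rz; elim: k => [|k IH]; first by rewrite addr0.
rewrite iterS -natr1; have := cmod_quad_ge c (iter k (quad c) z).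
have := cmod_ge0 c; have : 0 <= k%:R :> R by [].
move: (cmod (iter k _ z)) (cmod (quad c _)) IH => a b IH k0 c0 h.
have ca : cmod c <= a - 3 by move: hr; lra.
have : 0 <= a * (a - 3) by apply: mulr_ge0; lra.
rewrite expr2 in h; lra.
Qed.

Lemma filled_juliaP z : filled_julia c z <-> forall k, cmod (iter k (quad c) z) <= r.
Proof.
split=> [/bounded_cmod[B hB] k|h]; last by apply/bounded_cmod; exists r.
rewrite leNgt; apply/negP => /escape h.
have := h (Num.truncn B).+1; rewrite -iterD; have := hB ((Num.truncn B).+1 + k)%N.
by have := truncnS_gt B; have := cmod_ge0 (iter k (quad c) z); lra.
Qed.

Lemma filled_julia_quad z : filled_julia c z -> filled_julia c (quad c z).
Proof. by move=> /filled_juliaP h; apply/filled_juliaP => k; rewrite -iterSr. Qed.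

Lemma filled_julia_preim z : filled_julia c (quad c z) -> filled_julia c z.
Proof.
move=> /filled_juliaP h; apply/filled_juliaP => -[|k]; last by rewrite iterSr.
by have := quad_preim_small hr (h 0%N); rewrite /=; lra.
Qed.

Lemma filled_julia_closed z :
  (forall e : R, 0 < e -> exists2 y, filled_julia c y & cmod (y - z) <= e) -> filled_julia c z.
Proof.
move=> hz; apply/filled_juliaP => k.
have [L L0 hL] := iter_quad_lipschitz c k (r + 1).
apply/ler_addgt0Pr => e e0.
have e0' : 0 < Num.min 1 (e / L) by rewrite lt_min ltr01 divr_gt0.
have [y /filled_juliaP Jy] := hz _ e0'; rewrite le_min => /andP[y1 y2].
have yr := Jy 0%N; rewrite /= in yr.
have zr : cmod z <= r + 1 by have := cmod_triB z y; rewrite cmodB; lra.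
have yr' : cmod y <= r + 1 by lra.
have := hL _ _ zr yr'; rewrite cmodB [cmod (z - y)]cmodB.
rewrite ler_pdivlMr // mulrC in y2.
have := cmod_triB (iter k (quad c) z) (iter k (quad c) y); rewrite cmodB.
have := Jy k; lra.
Qed.

End FilledJulia.

Lemma derivable_cmod_continuous (R : realType) (T : Cplx R -> Cplx R) (z : Cplx R) :
  derivable T z 1 -> forall e : R, 0 < e ->
  exists2 d : R, 0 < d & forall y, cmod (y - z) < d -> cmod (T y - T z) < e.
Proof.
move=> /derivable1_diffP /differentiable_continuous hc e e0.
have : nbhs (T z) [set u | cmod (u - T z) < e] by apply/nbhs_cmod; exists e.
by move=> /hc /nbhs_cmod [d d0 hd]; exists d.
Qed.

Theorem theorem4p3 (R : realType) (c : Cplx R) (hc : ~ mandelbrot c)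
    (s : R) (hs0 : green c 0 < s) (hsc : s < green c c)
    (T1 T2 : Cplx R -> Cplx R)
    (hT : inverse_branches c (green_disk c s) T1 T2)
    (z1 : Cplx R) (hz1 : green_disk c s z1) (hfix : T1 z1 = z1) :
  absolutely_convergent
    (fun w : seq bool => (-1) ^+ eta w *
       (word_act T1 T2 w (T1 (- z1)) - word_act T1 T2 w (T2 (- z1))))
  <-> (hausdorff_dim (julia c) < 1)%E.
Proof.
have [n [r1 [r2 [hr h12 h0 hcrit hD]]]] := exists_polynomial_disk (cmod c + 3) hs0 hsc.
case: hT => hol1 _ q1 q2 neg.
have hr2 : cmod c + 3 <= r2 by apply: le_trans hr (ltW h12).
have r10 : 0 < r1 by have := cmod_ge0 c; lra.
pose E := level c n r1.
have E2 z : E z -> level c n r2 z by rewrite /E /level /= => h; apply: le_trans h (ltW h12).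
have ED z : E z -> green_disk c s z by move=> /E2 /hD.
pose Tb := letter_act T1 T2.
have quadT b z : E z -> quad c (Tb b z) = z.
  by move=> /ED; case: b; [exact: q2|exact: q1].
have [kappa kappa0 hk] : exists2 k0 : R, 0 < k0 &
    forall x y, E x -> E y -> k0 <= cmod (T1 x + T1 y).
  apply: (branch_sum_lower hr h12 hcrit) => z hz; first exact/q1/hD.
  apply: derivable_cmod_continuous; exact: nbhs_singleton (hol1 _ (hD _ hz)).
have T_sum b x y : E x -> E y -> kappa <= cmod (Tb b x + Tb b y).
  move=> Ex Ey; case: b; rewrite /Tb /letter_act; last exact: hk.
  by rewrite (neg _ (ED _ Ex)) (neg _ (ED _ Ey)) -opprD cmodN hk.
have T_sep x y : E x -> E y -> kappa <= cmod (T1 x - T2 y).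
  by move=> Ex Ey; rewrite (neg _ (ED _ Ey)) opprK hk.
have [d d0 hd] := @level_thicken R c n (r1 - 1) r1 hr ltac:(lra).
have T_thick b z h : E z -> cmod h <= d -> E (Tb b z + h).
  move=> Ez hh; apply: (hd (Tb b z)); last by rewrite addrC addKr.
  by apply: levelS_inner => //; rewrite levelS_quad quadT.
have EB z : E z -> cmod z <= r1 by exact: level_norm.
have TE b z : E z -> E (Tb b z).
  by move=> hz; rewrite -[Tb b z]addr0; apply: T_thick; rewrite ?cmod0 // ltW.
have [l l01 [C C0 contr]] : exists2 l : R, 0 <= l < 1 & exists2 C : R, 0 < C &
    forall w x y, E x -> E y ->
      cmod (word_act T1 T2 w x - word_act T1 T2 w y) <= C * l ^+ size w.
  apply: (@word_act_contracts R c E T1 T2 r1 kappa d) => //.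
  by move=> e e0; exact: level_chain.
have [K K1 distort] := word_act_distortion kappa0 C0 l01 quadT TE T_sum contr.
pose J := filled_julia c.
have JE z : J z -> E z by move=> /(filled_juliaP hr); apply.
have TJ b z : J z -> J (Tb b z).
  by move=> Jz; apply: (filled_julia_preim hr); rewrite quadT //; exact: JE.
have J_split z : J z -> exists b y, J y /\ z = Tb b y.
  move=> Jz; have Jq := filled_julia_quad hr Jz.
  have : z ^+ 2 = T1 (quad c z) ^+ 2.
    by apply: (addIr c); rewrite -[LHS]/(quad c z) -[RHS]/(quad c _) (quadT false) //; exact: JE.
  move/eqP; rewrite eqf_sqr => /orP[/eqP h|/eqP h].
    by exists false, (quad c z).
  by exists true, (quad c z); split=> //; rewrite /Tb /letter_act neg //; exact/ED/JE.
have J_closed z : (forall e : R, 0 < e -> exists2 y, J y & cmod (y - z) <= e) -> J z.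
  exact: filled_julia_closed.
have qz1 : quad c z1 = z1 by rewrite -{1}hfix q1.
have iz1 k : iter k (quad c) z1 = z1 by elim: k => //= k ->.
have Jz1 : J z1 by apply/bounded_cmod; exists (cmod z1) => k; rewrite iz1.
have JNz1 : J (- z1).
  by apply: (filled_julia_preim hr); rewrite /quad sqrrN -/(quad c z1) qz1.
have sep := T_sep _ _ (JE _ JNz1) (JE _ JNz1).
have a12 : T1 (- z1) != T2 (- z1).
  by rewrite -subr_eq0 -cmod_gt0; exact: lt_le_trans sep.
have T_inj b x y : E x -> E y -> Tb b x = Tb b y -> x = y.
  by move=> Ex Ey h; rewrite -(quadT b _ Ex) h quadT.
have main := limit_set_dim_lt1 C0 l01 K1 kappa0 TE T_inj T_sep contr distort JE TJ J_split
  J_closed Jz1 (TE false _ (JE _ JNz1)) (TE true _ (JE _ JNz1)) a12.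
have notJ0 : ~ J 0.
  move=> /(filled_juliaP hr) /(_ n.+1); rewrite iterSr {2}/quad expr0n add0r.
  by move: hcrit h12; lra.
have undo w y : E y -> iter (size w) (quad c) (word_act T1 T2 w y) = y.
  move=> Ey; elim: w => // b w IH; rewrite [size _]/= iterSr /= -/(Tb b) quadT //.
  exact: word_act_stable.
(* J is closed, and has no interior: the points [w 0] escape and come close to
   every point of J. *)
have -> : julia c = J.
  apply/seteqP; split=> [z [clz _]|z Jz].
    apply: J_closed => e e0.
    have [|y [Jy hy]] := clz [set y | cmod (y - z) < e]; first by apply/nbhs_cmod; exists e.
    by exists y => //; exact: ltW.
  split; first exact: subset_closure.
  rewrite /interior => /nbhs_cmod[e e0 he].
  have [N /(_ N (leqnn N)) hN] := geometric_small C l01 e0.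
  have [w [y [sw Jy ezy]]] := limit_set_code J_split N Jz.
  apply: notJ0; rewrite -(undo w 0) //.
  have : J (word_act T1 T2 w 0).
    apply: he; rewrite ezy; apply: le_lt_trans hN; rewrite -sw.
    by apply: contr => //; exact: JE.
  by elim: (size w) (word_act _ _ _ _) => //= k IH u Ju; rewrite -iterS iterSr; apply/IH/filled_julia_quad.
rewrite absolutely_convergent_words -main.
have E1 M : \sum_(w <- words_lt M) cmod ((-1) ^+ eta w *
    (word_act T1 T2 w (T1 (- z1)) - word_act T1 T2 w (T2 (- z1)))) =
  \sum_(w <- words_lt M) cmod (word_act T1 T2 w (T1 (- z1)) - word_act T1 T2 w (T2 (- z1))).
  by apply: eq_bigr => w _; rewrite cmodM cmodX cmodN cmod1 expr1n mul1r.
by split=> -[B hB]; exists B => M; [rewrite -E1|rewrite E1].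
Qed.
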